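(* Let $\gamma$ be a non-zero ordinal, written $\gamma=\omega^{\epsilon_0}+\ldots+\omega^{\epsilon_l}$ with $\epsilon_0\geqslant\ldots\geqslant\epsilon_l$. Let $\gamma_0=0$ and $\gamma_{i+1}=\gamma_i+\omega^{\epsilon_i}$ for $i=0,\ldots,l$. For any tree $P$ with $\mathrm{rank}(P)=\gamma$, any $k<\omega$ and any $f:P\to k+1$, there exist a subtree $Q$ of $P$ and a function $F:l+1\to k+1$ such that $\mathrm{rank}(Q)=\mathrm{rank}(P)$ and for each $i\leqslant l$: (i) $Q^{\gamma_i}\setminus Q^{\gamma_{i+1}}=Q\cap(P^{\gamma_i}\setminus P^{\gamma_{i+1}})$; (ii) $\varsigma_{Q^{\gamma_i}\setminus Q^{\gamma_{i+1}}}=\varsigma_{P^{\gamma_i}\setminus P^{\gamma_{i+1}}}|_{\Lambda_2(Q^{\gamma_i}\setminus Q^{\gamma_{i+1}})}$; (iii) $f|_{Q^{\gamma_i}\setminus Q^{\gamma_{i+1}}}\equiv F(i)$.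
   Context: A tree is a partially ordered set $(P,\leqslant)$ such that for every $t\in P$ the set $\{s\in P: s\leqslant t\}$ is well-ordered; subsets carry the induced order. $\mathrm{Leaves}(P)$ is the set of maximal elements. $P'=P\setminus\mathrm{Leaves}(P)$; $P^0=P$, $P^{\xi+1}=(P^\xi)'$, $P^\xi=\bigcap_{\zeta<\xi}P^\zeta$ for limit $\xi$. For well-founded $P$, $\mathrm{rank}(P)=\min\{\xi:P^\xi=\varnothing\}$ and $\tau_{P,\beta}(t)=\max\{\xi:t\in P^{\beta\cdot\xi}\}$ for $\beta>0$. $\Lambda_2(P)=\{(s,t)\in P\times P:s<t\}$. Each set $P^{\gamma_i}\setminus P^{\gamma_{i+1}}$ (and $Q^{\gamma_i}\setminus Q^{\gamma_{i+1}}$) has rank $\omega^{\epsilon_i}$, an additively indecomposable ordinal. Separation: for $\delta=\omega^{\omega^{\eta_0}}\cdot\ldots\cdot\omega^{\omega^{\eta_m}}$ with $\eta_0\geqslant\ldots\geqslant\eta_m$ (unique representation of an additively indecomposable $\delta>1$), let $\alpha_i=\omega^{\omega^{\eta_0}}\cdot\ldots\cdot\omega^{\omega^{\eta_i}}$; for a tree $T$ of rank $\delta$, $\varsigma_T(s,t)=\min\{i\leqslant m:\tau_{T,\alpha_i}(s)=\tau_{T,\alpha_i}(t)\}$ for $(s,t)\in\Lambda_2(T)$. For a tree of rank $1$, $\Lambda_2$ is empty and the separation is the empty function. *)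

(* Defs.v *)
From HB Require Import structures.
From mathcomp Require Import all_boot all_order.
From mathcomp Require Import boolp classical_sets.

Set Implicit Arguments.
Unset Strict Implicit.
Unset Printing Implicit Defensive.

Import Order.TTheory.
Local Open Scope classical_set_scope.
Local Open Scope quotient_scope.

(* Ordinals.  [Node f] denotes the least ordinal strictly above all the [f i];
   several terms denote the same ordinal, so [Ord] is the quotient by mutual
   [tle].  The lemmas up to [opow_lim] show that the operations obey the usual
   clauses at zero, successors and limits. *)

Inductive otree : Type := Node (L : Type) (f : L -> otree).

Definition oidx (a : otree) : Type :=
  match a with Node L _ => L end.
Definition osub (a : otree) : oidx a -> otree :=
  match a with Node _ f => f end.

Fixpoint tle (a b : otree) {struct a} : Prop :=
  match a with Node L f => forall i : L, exists j : oidx b, tle (f i) (osub j) end.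

Definition tlt (a b : otree) : Prop := exists j : oidx b, tle a (osub j).

Lemma tleE a b : tle a b <-> forall i : oidx a, tlt (osub i) b.
Proof. by case: a. Qed.

Lemma tle_refl a : tle a a.
Proof. by elim: a => L f IH i; exists i; apply: IH. Qed.

Lemma tle_trans b a c : tle a b -> tle b c -> tle a c.
Proof.
elim: b a c => J g IH [L f] [K h] /= ab bc i.
have [j ij] := ab i; have [k jk] := bc j.
by exists k; apply: (IH j).
Qed.

Lemma tle_lt_trans b a c : tle a b -> tlt b c -> tlt a c.
Proof. by move=> ab [k bk]; exists k; apply: tle_trans bk. Qed.

Lemma tlt_le_trans b a c : tlt a b -> tle b c -> tlt a c.
Proof. by move=> [j aj] /tleE /(_ j); apply: tle_lt_trans. Qed.

Lemma tlt_sub a (i : oidx a) : tlt (osub i) a.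
Proof. by exists i; apply: tle_refl. Qed.

Lemma tltW a b : tlt a b -> tle a b.
Proof.
elim: a b => L f IH b ltab; apply/tleE => i.
case: ltab => j lej; exists j; apply: IH.
by apply: tlt_le_trans lej; apply: (@tlt_sub (Node f) i).
Qed.

Lemma tle_nlt a b : ~ tlt b a <-> tle a b.
Proof.
split; last first.
  elim: a b => L f IH b leab [i lebi].
  have /= [j leij] := leab i.
  apply: (IH i _ leij).
  by apply: tlt_le_trans lebi; apply: tlt_sub.
elim: a b => L f IH b nlt /= i.
case: (pselect (tlt (f i) b)) => // nltib; case: nlt; exists i.
apply/tleE => j; case: (pselect (tlt (osub j) (f i))) => // /IH leij.
by case: nltib; exists j.
Qed.

Lemma tle_total a b : tle a b \/ tle b a.
Proof.
case: (pselect (tlt b a)) => [/tltW|/tle_nlt]; [by right | by left].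
Qed.

HB.instance Definition _ := gen_eqMixin otree.
HB.instance Definition _ := gen_choiceMixin otree.

Definition teq (a b : otree) : bool := `[< tle a b /\ tle b a >].

Lemma teq_refl : reflexive teq.
Proof. by move=> a; apply/asboolP; split; apply: tle_refl. Qed.
Lemma teq_sym : symmetric teq.
Proof. by move=> a b; apply/asboolP/asboolP => -[]. Qed.
Lemma teq_trans : transitive teq.
Proof.
move=> b a c /asboolP[ab ba] /asboolP[bc cb]; apply/asboolP.
by split; apply: (@tle_trans b).
Qed.

Canonical teq_equiv := EquivRel teq teq_refl teq_sym teq_trans.

Definition Ord := {eq_quot teq}.
HB.instance Definition _ := Choice.on Ord.

Definition ocls (a : otree) : Ord := \pi_{eq_quot teq} a.
Definition orep (x : Ord) : otree := repr x.

Lemma orepK x : ocls (orep x) = x. Proof. exact: reprK. Qed.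

Lemma ocls_eq a b : ocls a = ocls b <-> tle a b /\ tle b a.
Proof.
split=> [/eqP|ab]; first by rewrite /ocls piE => /asboolP.
by apply/eqP; rewrite /ocls piE; apply/asboolP.
Qed.

Lemma orep_cls a : tle (orep (ocls a)) a /\ tle a (orep (ocls a)).
Proof. by apply/ocls_eq; rewrite orepK. Qed.

Definition ole (x y : Ord) : bool := `[< tle (orep x) (orep y) >].

Lemma ole_refl : reflexive ole.
Proof. by move=> x; apply/asboolP; apply: tle_refl. Qed.
Lemma ole_anti : antisymmetric ole.
Proof.
by move=> x y /andP[/asboolP xy /asboolP yx]; rewrite -[x]orepK -[y]orepK;
   apply/ocls_eq.
Qed.
Lemma ole_trans : transitive ole.
Proof.
by move=> y x z /asboolP xy /asboolP yz; apply/asboolP; apply: tle_trans yz.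
Qed.

Fact ord_display : Order.disp_t. Proof. exact: Order.Disp tt tt. Qed.
HB.instance Definition _ :=
  Order.Le_isPOrder.Build ord_display Ord ole_refl ole_anti ole_trans.

Lemma ole_total : total (<=%O : rel Ord).
Proof.
by move=> x y; apply/orP; case: (tle_total (orep x) (orep y)) => le;
   [left | right]; apply/asboolP.
Qed.
HB.instance Definition _ := Order.POrder_isTotal.Build ord_display Ord ole_total.

Lemma ole_rep (x y : Ord) : (x <= y)%O <-> tle (orep x) (orep y).
Proof. by split=> [/asboolP|?]; last exact/asboolP. Qed.

Lemma ole_cls a b : (ocls a <= ocls b)%O <-> tle a b.
Proof.
have [a1 a2] := orep_cls a; have [b1 b2] := orep_cls b.
split=> [/ole_rep ab|ab]; last apply/ole_rep.
  by apply: (tle_trans a2); apply: tle_trans b1.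
by apply: (tle_trans a1); apply: tle_trans b2.
Qed.

Lemma olt_cls a b : (ocls a < ocls b)%O <-> tlt a b.
Proof.
rewrite ltNge; split=> [/negP nle|ab].
  by case: (pselect (tlt a b)) => // /tle_nlt /ole_cls.
by apply/negP => /ole_cls /tle_nlt.
Qed.

Lemma ord_ind (p : Ord -> Prop) :
  (forall x, (forall y, (y < x)%O -> p y) -> p x) -> forall x, p x.
Proof.
move=> IH x; suff: forall a b, tle b a -> p (ocls b).
  by move=> /(_ (orep x) (orep x) (tle_refl _)); rewrite orepK.
elim=> L f IHa b leba; apply: IH => y; rewrite -[y]orepK => /olt_cls ltyb.
by have [i leyi] := tlt_le_trans ltyb leba; apply: (IHa i).
Qed.

Definition omin (S : set Ord) : Ord :=
  xget (ocls (Node (of_void otree)))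
       [set x | S x /\ forall y, S y -> (x <= y)%O].
(* meaningful only when [S] has a largest element *)
Definition omax (S : set Ord) : Ord :=
  xget (ocls (Node (of_void otree)))
       [set x | S x /\ forall y, S y -> (y <= x)%O].

Lemma ominP (S : set Ord) :
  S !=set0 -> S (omin S) /\ forall y, S y -> (omin S <= y)%O.
Proof.
move=> S0; rewrite /omin; case: xgetP => // nmin; case: S0 => x Sx; exfalso; move: Sx.
elim/ord_ind: x => x IH Sx; apply: (nmin x); split=> // y Sy.
by rewrite leNgt; apply/negP => /IH.
Qed.

(* Arithmetic; [tsup h] is the supremum of the family [h], and sums, products
   and powers are defined by recursion on their second argument. *)

Definition tsup (J : Type) (h : J -> otree) : otree :=
  Node (fun x : {j : J & oidx (h j)} => osub (projT2 x)).
Definition tzero : otree := Node (of_void otree).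
Definition tsucc (a : otree) : otree := Node (fun _ : unit => a).
Definition tomega : otree := Node (fun n : nat => iter n tsucc tzero).

Fixpoint tadd (a b : otree) {struct b} : otree :=
  match b with Node J g =>
    Node (fun x : oidx a + J =>
      match x with inl i => osub i | inr j => tadd a (g j) end)
  end.

Fixpoint tmul (a b : otree) {struct b} : otree :=
  match b with Node J g => tsup (fun j : J => tadd (tmul a (g j)) a) end.

Fixpoint tpow (b : otree) : otree :=
  match b with Node J g =>
    tsup (oapp (fun j : J => tmul (tpow (g j)) tomega) (tsucc tzero))
  end.

Definition ozero : Ord := ocls tzero.
Definition oone : Ord := ocls (tsucc tzero).
Definition omega : Ord := ocls tomega.
Definition oadd (x y : Ord) : Ord := ocls (tadd (orep x) (orep y)).
Definition omul (x y : Ord) : Ord := ocls (tmul (orep x) (orep y)).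
Definition opow (x : Ord) : Ord := ocls (tpow (orep x)).

Declare Scope ord_scope.
Delimit Scope ord_scope with ord.
Bind Scope ord_scope with Ord.
Notation "0" := ozero : ord_scope.
Notation "1" := oone : ord_scope.
Notation "x + y" := (oadd x y) : ord_scope.
Notation "x * y" := (omul x y) : ord_scope.
Notation "'ω^' x" := (opow x) (at level 30, x at level 30, format "'ω^' x") : ord_scope.
Local Open Scope ord_scope.

Definition is_limit (x : Ord) : Prop :=
  x <> 0 /\ forall y, (y < x)%O -> (y + 1 < x)%O.

Lemma tsup_le J (h : J -> otree) b : tle (tsup h) b <-> forall j, tle (h j) b.
Proof.
split=> [le j|le]; apply/tleE.
  by move=> i; apply: (le (existT _ j i)).
by move=> [j i]; move/tleE: (le j); apply.
Qed.

Lemma tsup_ub J (h : J -> otree) j : tle (h j) (tsup h).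
Proof. by move: j; apply/tsup_le; apply: tle_refl. Qed.

Lemma tsucc_lt a b : tlt a (tsucc b) <-> tle a b.
Proof. by split=> [[]|] //; exists tt. Qed.

Lemma tsucc_le a b : tle (tsucc a) b <-> tlt a b.
Proof. by split=> [/tleE /(_ tt)|lt] //; apply/tleE. Qed.

Lemma tadd_le a b c :
  tle (tadd a b) c <-> tle a c /\ forall j : oidx b, tlt (tadd a (osub j)) c.
Proof.
case: b => J g; split=> [/tleE le|[/tleE lea leb]].
  by split=> [|j]; [apply/tleE => i; apply: (le (inl i)) | apply: (le (inr j))].
by apply/tleE => -[i|j]; [apply: lea | apply: leb].
Qed.

Lemma tmul_le a b c :
  tle (tmul a b) c <-> forall j : oidx b, tle (tadd (tmul a (osub j)) a) c.
Proof. by case: b => J g; apply: tsup_le. Qed.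

Lemma tpow_le b c :
  tle (tpow b) c <->
  tle (tsucc tzero) c /\ forall j : oidx b, tle (tmul (tpow (osub j)) tomega) c.
Proof.
case: b => J g; split=> [/tsup_le le|[le1 le]].
  by split=> [|j]; [apply: (le None) | apply: (le (Some j))].
by apply/tsup_le => -[j|]; [apply: le | apply: le1].
Qed.

Lemma tadd_mono a a' b b' :
  tle a a' -> tle b b' -> tle (tadd a b) (tadd a' b').
Proof.
move=> aa'; elim: b b' => J g IH b' bb'; have [la la'] := proj1 (tadd_le a' b' _) (tle_refl _).
apply/tadd_le; split=> [|j]; first exact: tle_trans la.
have [j' jj'] := bb' j.
by apply: tle_lt_trans (la' j'); apply: IH.
Qed.

Lemma tmul_mono a a' b b' :
  tle a a' -> tle b b' -> tle (tmul a b) (tmul a' b').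
Proof.
move=> aa'; elim: b b' => J g IH b' bb'; apply/tmul_le => j.
have [j' jj'] := bb' j.
apply: (@tle_trans (tadd (tmul a' (osub j')) a')); last first.
  exact: (proj1 (tmul_le a' b' _) (tle_refl _)).
by apply: tadd_mono => //; apply: IH.
Qed.

Lemma tpow_mono b b' : tle b b' -> tle (tpow b) (tpow b').
Proof.
elim: b b' => J g IH b' bb'.
have [l1 l2] := proj1 (tpow_le b' _) (tle_refl _).
apply/tpow_le; split=> [|j]; first exact: l1.
have [j' jj'] := bb' j.
apply: (@tle_trans (tmul (tpow (osub j')) tomega)); last exact: l2.
by apply: tmul_mono; [apply: IH | apply: tle_refl].
Qed.

Lemma oadd_cls a b : oadd (ocls a) (ocls b) = ocls (tadd a b).
Proof.
have [a1 a2] := orep_cls a; have [b1 b2] := orep_cls b.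
by apply/ocls_eq; split; apply: tadd_mono.
Qed.

Lemma omul_cls a b : omul (ocls a) (ocls b) = ocls (tmul a b).
Proof.
have [a1 a2] := orep_cls a; have [b1 b2] := orep_cls b.
by apply/ocls_eq; split; apply: tmul_mono.
Qed.

Lemma opow_cls b : opow (ocls b) = ocls (tpow b).
Proof. by have [b1 b2] := orep_cls b; apply/ocls_eq; split; apply: tpow_mono. Qed.

Lemma ocls_surj (x : Ord) : exists a, x = ocls a.
Proof. by exists (orep x); rewrite orepK. Qed.

Lemma tadd1 a : tle (tadd a (tsucc tzero)) (tsucc a) /\
                tle (tsucc a) (tadd a (tsucc tzero)).
Proof.
split; last first.
  by apply/tsucc_le; exists (inr tt); apply: (proj1 (proj1 (tadd_le a tzero _) (tle_refl _))).
apply/tadd_le; split=> [|j]; first by apply: tltW; apply/tsucc_lt/tle_refl.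
apply/tsucc_lt; suff: tle (tadd a tzero) a by [].
by apply/tadd_le; split=> [|[]]; apply: tle_refl.
Qed.

Lemma osucc_cls a : ocls a + 1 = ocls (tsucc a).
Proof. by rewrite oadd_cls; apply/ocls_eq; apply: tadd1. Qed.

Lemma ole0x (x : Ord) : (0 <= x)%O.
Proof. by have [a ->] := ocls_surj x; apply/ole_cls => -[]. Qed.

Lemma olt_succ (x y : Ord) : (x < y + 1)%O <-> (x <= y)%O.
Proof.
have [a ->] := ocls_surj x; have [b ->] := ocls_surj y.
by rewrite osucc_cls; split=> [/olt_cls/tsucc_lt/ole_cls|/ole_cls/tsucc_lt/olt_cls].
Qed.

Lemma olt_omega (x : Ord) :
  (x < omega)%O <-> exists n, x = iter n (fun y => y + 1) 0.
Proof.
have nE n : iter n (fun y => y + 1) 0 = ocls (iter n tsucc tzero).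
  by elim: n => //= n ->; rewrite osucc_cls.
split=> [|[n ->]]; last by rewrite nE; apply/olt_cls; exists n; apply: tle_refl.
elim/ord_ind: x => x IH ltx.
have [a xa] := ocls_surj x; move: (ltx); rewrite xa => /olt_cls [n /=].
rewrite -xa => /ole_cls; rewrite -xa -nE => {a xa}.
elim: n => [|n IHn] /= lex.
  by exists 0%N; apply/eqP; rewrite eq_le lex ole0x.
move: lex; rewrite le_eqVlt => /orP[/eqP ->|/olt_succ //]; by exists n.+1.
Qed.

Lemma oaddx0 x : x + 0 = x.
Proof.
have [a ->] := ocls_surj x; rewrite oadd_cls; apply/ocls_eq; split.
  by apply/tadd_le; split=> [|[]]; apply: tle_refl.
by have [] := proj1 (tadd_le a tzero _) (tle_refl _).
Qed.

Lemma oaddS x y : x + (y + 1) = (x + y) + 1.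
Proof.
have [a ->] := ocls_surj x; have [b ->] := ocls_surj y.
rewrite osucc_cls [ocls a + ocls b]oadd_cls osucc_cls oadd_cls; apply/ocls_eq; split.
  apply/tadd_le; split=> [|j]; last exact/tsucc_lt/tle_refl.
  apply: tltW; apply/tsucc_lt.
  by have [] := proj1 (tadd_le a b _) (tle_refl _).
by apply/tsucc_le; exists (inr tt); apply: tle_refl.
Qed.

Lemma olim_sub b (j : oidx b) : is_limit (ocls b) -> (ocls (tsucc (osub j)) < ocls b)%O.
Proof. by move=> [_ lim]; rewrite -osucc_cls; apply: lim; apply/olt_cls/tlt_sub. Qed.

Lemma oadd_lim x y z : is_limit y ->
  (x + y <= z)%O <-> (forall u, (u < y)%O -> (x + u <= z)%O).
Proof.
have [a ->] := ocls_surj x; have [b ->] := ocls_surj y; have [c ->] := ocls_surj z.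
move=> lim; rewrite oadd_cls; split=> [/ole_cls le u|le].
  have [d ->] := ocls_surj u; move=> /olt_cls/tltW db; rewrite oadd_cls; apply/ole_cls.
  by apply: tle_trans le; apply: tadd_mono => //; apply: tle_refl.
apply/ole_cls/tadd_le; split=> [|j].
  have /le : (0 < ocls b)%O.
    by rewrite lt_neqAle ole0x andbT eq_sym; apply/eqP; case: lim.
  by rewrite oaddx0 => /ole_cls.
have := le _ (olim_sub j lim); rewrite oadd_cls => /ole_cls.
by move=> /tadd_le [_ /(_ tt)].
Qed.

Lemma omulx0 x : x * 0 = 0.
Proof.
have [a ->] := ocls_surj x; rewrite omul_cls; apply/ocls_eq; split=> [|[]].
by apply/tmul_le => -[].
Qed.

Lemma omulS x y : x * (y + 1) = x * y + x.
Proof.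
have [a ->] := ocls_surj x; have [b ->] := ocls_surj y.
rewrite osucc_cls !omul_cls oadd_cls; apply/ocls_eq; split.
  by apply/tmul_le => /= _; apply: tle_refl.
exact: (proj1 (tmul_le a (tsucc b) _) (tle_refl _) tt).
Qed.

Lemma omul_lim x y z : is_limit y ->
  (x * y <= z)%O <-> (forall u, (u < y)%O -> (x * u <= z)%O).
Proof.
have [a ->] := ocls_surj x; have [b ->] := ocls_surj y; have [c ->] := ocls_surj z.
move=> lim; rewrite omul_cls; split=> [/ole_cls le u|le].
  have [d ->] := ocls_surj u; move=> /olt_cls/tltW db; rewrite omul_cls; apply/ole_cls.
  by apply: tle_trans le; apply: tmul_mono => //; apply: tle_refl.
apply/ole_cls/tmul_le => j.
have := le _ (olim_sub j lim); rewrite omul_cls => /ole_cls.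
by move=> /tmul_le /(_ tt).
Qed.

Lemma opow0 : ω^0 = 1.
Proof.
rewrite opow_cls; apply/ocls_eq; split; last first.
  by have [] := proj1 (tpow_le tzero _) (tle_refl _).
by apply/tpow_le; split=> [|[]]; apply: tle_refl.
Qed.

Lemma tpow_gt0 b : tlt tzero (tpow b).
Proof. by apply/tsucc_le; have [] := proj1 (tpow_le b _) (tle_refl _). Qed.

Lemma opowS x : ω^(x + 1) = ω^x * omega.
Proof.
have [b ->] := ocls_surj x; rewrite osucc_cls !opow_cls omul_cls.
apply/ocls_eq; split.
  apply/tpow_le; split=> [|j]; last exact: tle_refl.
  apply/tsucc_le; apply: tlt_le_trans (proj1 (tmul_le _ tomega _) (tle_refl _) 0%N).
  have [_ h] := proj1 (tadd_le (tmul (tpow b) tzero) (tpow b) _) (tle_refl _).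
  by have [j _] := tpow_gt0 b; apply: tle_lt_trans (h j) => -[].
exact: (proj2 (proj1 (tpow_le (tsucc b) _) (tle_refl _)) tt).
Qed.

Lemma opow_lim x z : is_limit x ->
  (ω^x <= z)%O <-> (forall u, (u < x)%O -> (ω^u <= z)%O).
Proof.
have [b ->] := ocls_surj x; have [c ->] := ocls_surj z.
move=> lim; rewrite opow_cls; split=> [/ole_cls le u|le].
  have [d ->] := ocls_surj u; move=> /olt_cls/tltW db; rewrite opow_cls; apply/ole_cls.
  by apply: tle_trans le; apply: tpow_mono.
apply/ole_cls/tpow_le; split=> [|j].
  have /le : (0 < ocls b)%O.
    by rewrite lt_neqAle ole0x andbT eq_sym; apply/eqP; case: lim.
  by rewrite opow0 => /ole_cls.
have := le _ (olim_sub j lim); rewrite opow_cls => /ole_cls.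
by move=> /tpow_le [_ /(_ tt)].
Qed.

(* [cnf_sum e i] = ω^e_0 + ... + ω^e_(i-1), associated to the left *)
Fixpoint cnf_sum (e : nat -> Ord) (i : nat) : Ord :=
  if i is j.+1 then cnf_sum e j + ω^(e j) else 0.

(* [cnf_prod n i] = ω^ω^n_0 * ... * ω^ω^n_(i-1) *)
Fixpoint cnf_prod (n : nat -> Ord) (i : nat) : Ord :=
  if i is j.+1 then cnf_prod n j * ω^(ω^(n j)) else 1.

(* Trees.  A subset of [P], with the induced order, is a value of [set P]. *)

Section Trees.
Context (d : Order.disp_t) (P : porderType d).
Implicit Types (A : set P) (s t : P).

Definition is_tree : Prop :=
  forall (t : P) (A : set P), A `<=` [set s | (s <= t)%O] -> A !=set0 ->
    exists2 m, A m & forall s, A s -> (m <= s)%O.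

Definition leaves A : set P := [set t | A t /\ forall s, A s -> ~ (t < s)%O].

Definition deriv A : set P := A `\` leaves A.

Fixpoint tderivs A (a : otree) : set P :=
  match a with Node L f =>
    A `&` [set t | forall i : L, deriv (tderivs A (f i)) t]
  end.

(* the iterated derivative A^ξ *)
Definition derivs A (ξ : Ord) : set P := tderivs A (orep ξ).

Lemma deriv_mono A B : A `<=` B -> deriv A `<=` deriv B.
Proof.
move=> AB t [At nleaf]; split; first exact: AB.
by move=> [_ leaf]; apply: nleaf; split=> // s /AB; apply: leaf.
Qed.

Lemma tderivs_anti A a b : tle a b -> tderivs A b `<=` tderivs A a.
Proof.
elim: a b => L f IH [J g] leab t /= [At der]; split=> // i.
have /= [j ij] := leab i.
by apply: deriv_mono (der j); apply: IH.
Qed.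

Lemma derivs_cls A a : derivs A (ocls a) = tderivs A a.
Proof.
have [a1 a2] := orep_cls a.
by apply/seteqP; split; apply: tderivs_anti.
Qed.

Lemma derivs0 A : derivs A 0 = A.
Proof.
by rewrite derivs_cls; apply/seteqP; split=> t => [[]|At] //; split=> // -[].
Qed.

Lemma derivsS A ξ : derivs A (ξ + 1) = deriv (derivs A ξ).
Proof.
have [a ->] := ocls_surj ξ; rewrite osucc_cls !derivs_cls.
apply/seteqP; split=> t => [[_ /(_ tt)]|dt] //; split=> // .
by case: dt => + _; case: a => L f [].
Qed.

Lemma derivs_lim A ξ : is_limit ξ ->
  derivs A ξ = \bigcap_(ζ in [set ζ | (ζ < ξ)%O]) derivs A ζ.
Proof.
have [a ->] := ocls_surj ξ; move=> lim; apply/seteqP; split=> t.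
  move=> + ζ /=; have [b ->] := ocls_surj ζ; rewrite !derivs_cls => dt.
  by move=> /olt_cls/tltW ba; apply: tderivs_anti dt.
move=> der; have At : A t.
  rewrite -(derivs0 A); apply: der => /=.
  by rewrite lt_neqAle ole0x andbT eq_sym; apply/eqP; case: lim.
rewrite derivs_cls; case: a lim der => L f lim der; split=> // i.
have := der _ (@olim_sub (Node f) i lim); rewrite -osucc_cls derivsS.
by rewrite derivs_cls.
Qed.

(* Equal to 0 when no derivative of [A] is empty, i.e. A not well-founded; a
   nonzero rank therefore entails well-foundedness. *)
Definition rank A : Ord := omin [set ξ | derivs A ξ = set0].

Definition tau A (β : Ord) (t : P) : Ord := omax [set ξ | derivs A (β * ξ) t].

Definition Lambda2 A : set (P * P) :=
  [set st | [/\ A st.1, A st.2 & (st.1 < st.2)%O]].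

(* [i] is the value at (s, t) of the separation of [A]; the ordinals
   η_0 >= ... >= η_m with rank A = ω^ω^η_0 * ... * ω^ω^η_m are unique. *)
Definition is_separation A (st : P * P) (i : nat) : Prop :=
  exists (m : nat) (η : nat -> Ord),
    [/\ forall p q, (p <= q <= m)%N -> (η q <= η p)%O,
        rank A = cnf_prod η m.+1,
        (i <= m)%N,
        tau A (cnf_prod η i.+1) st.1 = tau A (cnf_prod η i.+1) st.2
      & forall j, (j < i)%N ->
          tau A (cnf_prod η j.+1) st.1 <> tau A (cnf_prod η j.+1) st.2].

(* Relevant only for pairs in [Lambda2 A], which is empty if rank A = 1. *)
Definition separation A (st : P * P) : nat := xget 0%N [set i | is_separation A st i].

(* A^γ_i \ A^γ_(i+1), where γ_i = ω^e_0 + ... + ω^e_(i-1) *)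
Definition layer A (e : nat -> Ord) (i : nat) : set P :=
  derivs A (cnf_sum e i) `\` derivs A (cnf_sum e i.+1).

End Trees.

Arguments is_tree {d} P.

(* Main.v *)
(* A layer of rank ω^ε is handled by induction along a factorization α·β of its
   rank with β = ω^b.  Each block P^(αζ) \ P^(α(ζ+1)) has rank α, so by induction it
   contains a homogeneous subset of rank α with the right separation.  For two
   colours c, let g_c(U) be the largest ξ such that such subsets of colour c can be
   stacked ξ times in U.  If U has rank at least α(N+1), where N = g_0(U) ⊕ g_1(U) is
   the natural sum, consider its block ζ = N: above each point q of it there is
   still rank αN, so neither g_c can drop from U to the points above q.  A
   homogeneous subset of this block therefore increases one g_c(U), a
   contradiction.  As ω^b is closed under ⊕, some g_c reaches β.  To assemble a
   stack of limit height ξ, pass to a maximal point above which that height is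
   available: above it the minimal points have heights smaller than ξ but cofinal
   in ξ, and the pieces above distinct minimal points do not interact.
   The layers are stacked on each other in the same way, colouring each point q of
   the bottom layer by f(q) together with the colours obtained for the layers
   above q. *)
Require Import Defs.
From mathcomp Require Import all_boot all_order.
From mathcomp Require Import boolp classical_sets.

Set Implicit Arguments.
Unset Strict Implicit.
Unset Printing Implicit Defensive.

Import Order.TTheory.
Local Open Scope classical_set_scope.
Local Open Scope ord_scope.

(** * Ordinal arithmetic *)

(** Together with the two lemmas after it, this restates the recursive clauses as bounds on
    ordinals. The arithmetic laws then follow by well-founded induction without a split into zero,
    successor and limit. *)
Lemma oadd_leP (x y z : Ord) :
  (x + y <= z)%O <-> (x <= z)%O /\ forall u, (u < y)%O -> (x + u < z)%O.
Proof.
have [a ->] := ocls_surj x; have [b ->] := ocls_surj y; have [c ->] := ocls_surj z.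
rewrite oadd_cls; split=> [/ole_cls/tadd_le[le1 le2]|[/ole_cls le1 le2]].
  split=> [|u]; first exact/ole_cls.
  have [e ->] := ocls_surj u => /olt_cls [j ej]; rewrite oadd_cls; apply/olt_cls.
  by apply: tle_lt_trans (le2 j); apply: tadd_mono ej; apply: tle_refl.
apply/ole_cls/tadd_le; split=> // j; apply/olt_cls.
by rewrite -oadd_cls; apply: le2; apply/olt_cls/tlt_sub.
Qed.

Lemma omul_leP (x y z : Ord) :
  (x * y <= z)%O <-> forall u, (u < y)%O -> (x * u + x <= z)%O.
Proof.
have [a ->] := ocls_surj x; have [b ->] := ocls_surj y; have [c ->] := ocls_surj z.
rewrite omul_cls; split=> [/ole_cls/tmul_le le u|le].
  have [e ->] := ocls_surj u => /olt_cls [j ej]; rewrite omul_cls oadd_cls; apply/ole_cls.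
  by apply: tle_trans (le j); do 2?[apply: tadd_mono || apply: tmul_mono] => //; apply: tle_refl.
apply/ole_cls/tmul_le => j; apply/ole_cls.
by rewrite -oadd_cls -omul_cls; apply: le; apply/olt_cls/tlt_sub.
Qed.

Lemma opow_leP (y z : Ord) :
  (ω^y <= z)%O <-> (1 <= z)%O /\ forall u, (u < y)%O -> (ω^u * omega <= z)%O.
Proof.
have [b ->] := ocls_surj y; have [c ->] := ocls_surj z.
rewrite opow_cls; split=> [/ole_cls/tpow_le[le1 le2]|[/ole_cls le1 le2]].
  split=> [|u]; first exact/ole_cls.
  have [e ->] := ocls_surj u => /olt_cls [j ej]; rewrite opow_cls omul_cls; apply/ole_cls.
  by apply: tle_trans (le2 j); apply: tmul_mono (tle_refl _); apply: tpow_mono.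
apply/ole_cls/tpow_le; split=> // j; apply/ole_cls.
by rewrite -omul_cls -opow_cls; apply: le2; apply/olt_cls/tlt_sub.
Qed.

Lemma olt0x (x : Ord) : x <> 0 <-> (0 < x)%O.
Proof. by rewrite lt_neqAle ole0x andbT eq_sym; split=> /eqP. Qed.

Lemma oltx0 (x : Ord) : (x < 0)%O = false.
Proof. by rewrite ltNge ole0x. Qed.

Lemma ltoS (x : Ord) : (x < x + 1)%O.
Proof. exact/olt_succ. Qed.

Lemma oleS (x y : Ord) : (x + 1 <= y)%O <-> (x < y)%O.
Proof.
split; first exact: lt_le_trans (ltoS x).
by rewrite !ltNge => /negP h; rewrite leNgt; apply/negP => /olt_succ.
Qed.

Lemma ge1P (x : Ord) : (1 <= x)%O <-> (0 < x)%O.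
Proof.
suff e : 0 + 1 = 1 by rewrite -{1}e; apply: oleS.
by rewrite osucc_cls.
Qed.

Lemma oadd0x (x : Ord) : 0 + x = x.
Proof.
elim/ord_ind: x => x IH; apply/eqP; rewrite eq_le; apply/andP; split.
  by apply/oadd_leP; split=> [|u ux]; rewrite ?ole0x // IH.
rewrite leNgt; apply/negP => h; move: (IH _ h) => e.
have [_ /(_ _ h)] := (oadd_leP 0 x (0 + x)).1 (lexx _).
by rewrite e ltxx.
Qed.

Lemma olt0_1 : (0 < 1 :> Ord)%O.
Proof. by rewrite -[1]oadd0x; apply: ltoS. Qed.

Lemma olt1 (x : Ord) : (x < 1)%O -> x = 0.
Proof. by rewrite -[1]oadd0x => /olt_succ h; apply/eqP; rewrite eq_le h ole0x. Qed.

Lemma lt_oadd2l (x y z : Ord) : (y < z)%O -> (x + y < x + z)%O.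
Proof. by have [_] := (oadd_leP x z _).1 (lexx _); apply. Qed.

Lemma le_oadd2l (x y z : Ord) : (y <= z)%O -> (x + y <= x + z)%O.
Proof. by rewrite le_eqVlt => /orP[/eqP -> //|/(lt_oadd2l x)/ltW]. Qed.

Lemma oadd_inj (x y z : Ord) : x + y = x + z -> y = z.
Proof.
by case: (ltgtP y z) => // /(lt_oadd2l x) + e; rewrite e ltxx.
Qed.

Lemma le_oaddr (x y : Ord) : (x <= x + y)%O.
Proof. by have [] := (oadd_leP x y _).1 (lexx _). Qed.

Lemma le_oaddl (x y : Ord) : (y <= x + y)%O.
Proof.
elim/ord_ind: y => y IH; rewrite leNgt; apply/negP => h.
by have := le_lt_trans (IH _ h) (lt_oadd2l x h); rewrite ltxx.
Qed.

Lemma lt_oaddP (u x y : Ord) :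
  (u < x + y)%O -> (u < x)%O \/ exists2 v, (v < y)%O & (u <= x + v)%O.
Proof.
move=> h; apply: contrapT => /not_orP[/negP h1 h2]; move: h.
rewrite ltNge => /negP; apply; apply/oadd_leP; split; first by rewrite leNgt.
move=> v vy; rewrite ltNge; apply/negP => uv; apply: h2; by exists v.
Qed.

Lemma lt_oadd_ex (u x y : Ord) : (0 < y)%O ->
  (u < x + y)%O -> exists2 v, (v < y)%O & (u <= x + v)%O.
Proof.
move=> y0 /lt_oaddP[/ltW ux|//]; exists 0 => //; by rewrite oaddx0.
Qed.

Lemma oaddA (x y z : Ord) : x + (y + z) = x + y + z.
Proof.
elim/ord_ind: z => z IH; apply/eqP; rewrite eq_le; apply/andP; split.
  apply/oadd_leP; split=> [|u /lt_oaddP[uy|[v vz uv]]].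
  - exact: le_trans (le_oaddr _ _) (le_oaddr _ _).
  - exact: lt_le_trans (lt_oadd2l x uy) (le_oaddr _ _).
  - by apply: le_lt_trans (le_oadd2l x uv) _; rewrite IH //; apply: lt_oadd2l.
apply/oadd_leP; split=> [|u uz]; first by apply/le_oadd2l/le_oaddr.
by rewrite -IH //; do 2 apply: lt_oadd2l.
Qed.

Lemma omin_ex (S : Ord -> Prop) :
  (exists x, S x) -> exists2 x, S x & forall y, (y < x)%O -> ~ S y.
Proof.
move=> [x Sx]; have [] := @ominP S (ex_intro _ x Sx).
move=> Sm le; exists (omin S) => // y; rewrite ltNge => /negP h Sy; exact/h/le.
Qed.

Lemma le_oadd_ex (x z : Ord) : (x <= z)%O -> exists w, z = x + w.
Proof.
move=> xz; have [] := @omin_ex (fun w => (z <= x + w)%O).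
  by exists z; apply: le_oaddl.
move=> w zw wmin; exists w; apply/eqP; rewrite eq_le zw /=.
by apply/oadd_leP; split=> // u /wmin /negP; rewrite -ltNge.
Qed.

Lemma le_oadd (x x' y y' : Ord) : (x <= x')%O -> (y <= y')%O -> (x + y <= x' + y')%O.
Proof.
have [a ->] := ocls_surj x; have [b ->] := ocls_surj y.
have [a' ->] := ocls_surj x'; have [b' ->] := ocls_surj y'.
by rewrite !oadd_cls => /ole_cls h1 /ole_cls h2; apply/ole_cls/tadd_mono.
Qed.

Lemma le_omul (x x' y y' : Ord) : (x <= x')%O -> (y <= y')%O -> (x * y <= x' * y')%O.
Proof.
have [a ->] := ocls_surj x; have [b ->] := ocls_surj y.
have [a' ->] := ocls_surj x'; have [b' ->] := ocls_surj y'.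
by rewrite !omul_cls => /ole_cls h1 /ole_cls h2; apply/ole_cls/tmul_mono.
Qed.

Lemma le_opow (x y : Ord) : (x <= y)%O -> (ω^x <= ω^y)%O.
Proof.
have [a ->] := ocls_surj x; have [b ->] := ocls_surj y.
by rewrite !opow_cls => /ole_cls h1; apply/ole_cls/tpow_mono.
Qed.

Lemma lt_omulP (u x y : Ord) :
  (u < x * y)%O -> exists2 v, (v < y)%O & (u < x * v + x)%O.
Proof.
move=> h; apply: contrapT => h2; move: h; rewrite ltNge => /negP; apply.
apply/omul_leP => v vy; rewrite leNgt; apply/negP => uv; apply: h2; by exists v.
Qed.

Lemma lt_omul_le (x u y : Ord) : (u < y)%O -> (x * u + x <= x * y)%O.
Proof. exact: (omul_leP x y _).1 (lexx _) _. Qed.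

Lemma omulDr (x y z : Ord) : x * (y + z) = x * y + x * z.
Proof.
elim/ord_ind: z => z IH; apply/eqP; rewrite eq_le; apply/andP; split.
  apply/omul_leP => u /lt_oaddP[uy|[v vz uv]].
    exact: le_trans (lt_omul_le x uy) (le_oaddr _ _).
  apply: (@le_trans _ _ (x * (y + v) + x)).
    by apply: le_oadd => //; apply: le_omul.
  by rewrite IH // -oaddA; apply/le_oadd2l/lt_omul_le.
apply/oadd_leP; split=> [|u /lt_omulP[v vz uv]].
  by apply: le_omul => //; apply: le_oaddr.
apply: lt_le_trans (lt_oadd2l (x * y) uv) _; rewrite oaddA -IH //.
by apply: lt_omul_le; apply: lt_oadd2l.
Qed.

Lemma omulx1 (x : Ord) : x * 1 = x.
Proof. by rewrite -[1]oadd0x omulS omulx0 oadd0x. Qed.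

Lemma omulA (x y z : Ord) : x * (y * z) = x * y * z.
Proof.
elim/ord_ind: z => z IH; apply/eqP; rewrite eq_le; apply/andP; split.
  apply/omul_leP => u /lt_omulP[v vz uv].
  rewrite -omulS; apply: (@le_trans _ _ (x * (y * v + y))).
    by apply: le_omul => //; apply/oleS.
  by rewrite omulDr IH //; apply: lt_omul_le.
by apply/omul_leP => u uz; rewrite -IH // -omulDr; apply: le_omul => //; apply: lt_omul_le.
Qed.

Lemma omul1x (x : Ord) : 1 * x = x.
Proof.
elim/ord_ind: x => x IH; apply/eqP; rewrite eq_le; apply/andP; split.
  by apply/omul_leP => u ux; rewrite IH //; apply/oleS.
rewrite leNgt; apply/negP => h; move: (IH _ h) => e.
have := lt_omul_le 1 h; rewrite e => /oleS; by rewrite ltxx.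
Qed.

Lemma le_omulr (x y : Ord) : (0 < y)%O -> (x <= x * y)%O.
Proof. by move=> /ge1P y1; rewrite -{1}[x]omulx1; apply: le_omul. Qed.

Lemma le_omull (x y : Ord) : (0 < x)%O -> (y <= x * y)%O.
Proof. by move=> /ge1P y1; rewrite -{1}[y]omul1x; apply: le_omul. Qed.

Lemma omul_gt0 (x y : Ord) : (0 < x)%O -> (0 < y)%O -> (0 < x * y)%O.
Proof. by move=> x0 y0; apply: lt_le_trans (le_omulr x y0). Qed.

Lemma lt_omul2l (x y z : Ord) : (0 < x)%O -> (y < z)%O -> (x * y < x * z)%O.
Proof.
move=> x0 yz; apply: lt_le_trans (lt_omul_le x yz).
by rewrite -{1}[x * y]oaddx0; apply: lt_oadd2l.
Qed.

Lemma succ_or_limit x : [\/ x = 0, exists y, x = y + 1 | is_limit x].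
Proof.
have [->|x0] := pselect (x = 0); first by constructor 1.
have [h|h] := pselect (exists y, x = y + 1); first by constructor 2.
constructor 3; split=> // y /oleS; rewrite le_eqVlt => /orP[/eqP e|//].
by case: h; exists y.
Qed.

Lemma lt_omul_lim x y u : is_limit y -> (u < x * y)%O -> exists2 v, (v < y)%O & (u < x * v)%O.
Proof.
move=> lim h; apply: contrapT => h2; move: h; rewrite ltNge => /negP; apply.
apply/(omul_lim _ _ lim) => v vy; rewrite leNgt; apply/negP => uv.
by apply: h2; exists v.
Qed.

Lemma opow_gt0 (x : Ord) : (0 < ω^x)%O.
Proof. by apply/ge1P; have [] := (opow_leP x _).1 (lexx _). Qed.

Lemma lt_opow_le (u x : Ord) : (u < x)%O -> (ω^u * omega <= ω^x)%O.
Proof. by have [_] := (opow_leP x _).1 (lexx _); apply. Qed.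

Lemma lt_opowP (u x : Ord) :
  (u < ω^x)%O -> u = 0 \/ exists2 v, (v < x)%O & (u < ω^v * omega)%O.
Proof.
move=> h; apply: contrapT => /not_orP[h1 h2]; move: h.
rewrite ltNge => /negP; apply; apply/opow_leP; split; first exact/ge1P/olt0x.
move=> v vx; rewrite leNgt; apply/negP => uv; apply: h2; by exists v.
Qed.

Definition onat (n : nat) : Ord := iter n (fun y => y + 1) 0.

Lemma lt_onat_omega n : (onat n < omega)%O.
Proof. by apply/olt_omega; exists n. Qed.

Lemma lt_opow (x y : Ord) : (x < y)%O -> (ω^x < ω^y)%O.
Proof.
move=> xy; apply: lt_le_trans (lt_opow_le xy).
rewrite -{1}[ω^x]omulx1; apply: lt_omul2l (opow_gt0 _) _.
by rewrite -[1]oadd0x; apply: (lt_onat_omega 1).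
Qed.

Lemma opow_inj (x y : Ord) : ω^x = ω^y -> x = y.
Proof. by case: (ltgtP x y) => // /lt_opow + e; rewrite e ltxx. Qed.

Lemma opowD (x y : Ord) : ω^(x + y) = ω^x * ω^y.
Proof.
elim/ord_ind: y => y IH; apply/eqP; rewrite eq_le; apply/andP; split.
  apply/opow_leP; split=> [|u /lt_oaddP[ux|[v vy uv]]].
  - by apply/ge1P/omul_gt0; apply: opow_gt0.
  - exact: le_trans (lt_opow_le ux) (le_omulr _ (opow_gt0 y)).
  - apply: (@le_trans _ _ (ω^(x + v) * omega)).
      by apply: le_omul => //; apply: le_opow.
    by rewrite IH // -omulA; apply: le_omul => //; apply: lt_opow_le.
apply/omul_leP => u /lt_opowP[->|[v vy uv]].
  by rewrite omulx0 oadd0x; apply/le_opow/le_oaddr.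
rewrite -omulS; apply: (@le_trans _ _ (ω^x * (ω^v * omega))).
  by apply: le_omul => //; apply/oleS.
by rewrite omulA -IH //; apply/lt_opow_le/lt_oadd2l.
Qed.

(* The natural (Hessenberg) sum. *)
Fixpoint tnadd (a : otree) : otree -> otree :=
  match a with Node L f =>
    fix rec (b : otree) : otree :=
      match b with Node J g =>
        Node (fun x : L + J =>
          match x with inl i => tnadd (f i) b | inr j => rec (g j) end)
      end
  end.

Lemma tnadd_le a b c : tle (tnadd a b) c <->
  (forall i : oidx a, tlt (tnadd (osub i) b) c) /\
  (forall j : oidx b, tlt (tnadd a (osub j)) c).
Proof.
case: a b => L f [J g]; split=> [/tleE le|[le1 le2]].
  by split=> [i|j]; [apply: (le (inl i)) | apply: (le (inr j))].
by apply/tleE => -[i|j]; [apply: le1 | apply: le2].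
Qed.

Lemma tnadd_mono a a' b b' :
  tle a a' -> tle b b' -> tle (tnadd a b) (tnadd a' b').
Proof.
elim: a a' b b' => L f IHa a' b b' aa'; elim: b b' => J g IHb b' bb'.
have [l1 l2] := (tnadd_le a' b' _).1 (tle_refl _).
apply/tnadd_le; split=> [i|j].
  by have [i' ii'] := aa' i; apply: tle_lt_trans (l1 i'); apply: IHa.
by have [j' jj'] := bb' j; apply: tle_lt_trans (l2 j'); apply: IHb.
Qed.

Definition onadd (x y : Ord) : Ord := ocls (tnadd (orep x) (orep y)).

Lemma onadd_cls a b : onadd (ocls a) (ocls b) = ocls (tnadd a b).
Proof.
have [a1 a2] := orep_cls a; have [b1 b2] := orep_cls b.
by apply/ocls_eq; split; apply: tnadd_mono.
Qed.

Lemma onadd_leP (x y z : Ord) : (onadd x y <= z)%O <->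
  (forall u, (u < x)%O -> (onadd u y < z)%O) /\
  (forall u, (u < y)%O -> (onadd x u < z)%O).
Proof.
have [a ->] := ocls_surj x; have [b ->] := ocls_surj y; have [c ->] := ocls_surj z.
rewrite onadd_cls; split=> [/ole_cls/tnadd_le[le1 le2]|[le1 le2]].
  split=> u; have [e ->] := ocls_surj u => /olt_cls [j ej]; rewrite onadd_cls; apply/olt_cls.
    by apply: tle_lt_trans (le1 j); apply: tnadd_mono => //; apply: tle_refl.
  by apply: tle_lt_trans (le2 j); apply: tnadd_mono => //; apply: tle_refl.
apply/ole_cls/tnadd_le; split=> j; apply/olt_cls; rewrite -onadd_cls.
  by apply: le1; apply/olt_cls/tlt_sub.
by apply: le2; apply/olt_cls/tlt_sub.
Qed.

Lemma lt_onaddl (u x y : Ord) : (u < x)%O -> (onadd u y < onadd x y)%O.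
Proof. by have [+ _] := (onadd_leP x y _).1 (lexx _); apply. Qed.

Lemma lt_onaddr (u x y : Ord) : (u < y)%O -> (onadd x u < onadd x y)%O.
Proof. by have [_] := (onadd_leP x y _).1 (lexx _); apply. Qed.

Lemma le_onaddl (u x y : Ord) : (u <= x)%O -> (onadd u y <= onadd x y)%O.
Proof. by rewrite le_eqVlt => /orP[/eqP ->|/(lt_onaddl y)/ltW]. Qed.

Lemma le_onaddr (u x y : Ord) : (u <= y)%O -> (onadd x u <= onadd x y)%O.
Proof. by rewrite le_eqVlt => /orP[/eqP ->|/(lt_onaddr x)/ltW]. Qed.

Definition onadd_closed (z : Ord) : Prop :=
  forall a b, (a < z)%O -> (b < z)%O -> (onadd a b < z)%O.

(** Take u below one summand, say z·p + a. If u < z·p, then u <= z·(p-1) + v with v < z; the outer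
    induction on p + q saves one z, and by closure v ⊕ b fits into it. Otherwise u <= z·p + v with v
    < a, and the inner induction applies. *)
Lemma onadd_mul_onat (z : Ord) : onadd_closed z -> forall (p q : nat) a b,
  (a < z)%O -> (b < z)%O ->
  (onadd (z * onat p + a) (z * onat q + b) <= z * onat (p + q) + onadd a b)%O.
Proof.
move=> cl p q; move: {2}(p + q)%N (leqnn (p + q)) => N; elim: N p q.
  move=> p q; rewrite leqn0 addn_eq0 => /andP[/eqP -> /eqP ->] a b _ _.
  by rewrite omulx0 !oadd0x.
move=> N IHN p q pqN a; elim/ord_ind: a => a IHa b; elim/ord_ind: b => b IHb az bz.
have z0 : (0 < z)%O by apply: le_lt_trans az; apply: ole0x.
apply/onadd_leP; split=> u /lt_oaddP[|[v va uv]].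
- case: p pqN {IHa IHb} => [|p]; first by rewrite omulx0 oltx0.
  rewrite addSn ltnS => pqN /=; rewrite omulS => /(lt_oadd_ex z0)[v vz uv].
  apply: le_lt_trans (le_onaddl _ uv) _; apply: le_lt_trans (IHN _ _ pqN _ _ vz bz) _.
  rewrite omulS; apply: lt_le_trans (le_oaddr _ _); apply: lt_oadd2l; exact: cl.
- apply: le_lt_trans (le_onaddl _ uv) _.
  apply: le_lt_trans (IHa _ va _ (lt_trans va az) bz) _.
  by apply/lt_oadd2l/lt_onaddl.
- case: q pqN {IHa IHb} => [|q]; first by rewrite omulx0 oltx0.
  rewrite addnS ltnS => pqN /=; rewrite omulS => /(lt_oadd_ex z0)[v vz uv].
  apply: le_lt_trans (le_onaddr _ uv) _; apply: le_lt_trans (IHN _ _ pqN _ _ az vz) _.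
  rewrite omulS; apply: lt_le_trans (le_oaddr _ _); apply: lt_oadd2l; exact: cl.
- apply: le_lt_trans (le_onaddr _ uv) _.
  apply: le_lt_trans (IHb _ va az (lt_trans va bz)) _.
  by apply/lt_oadd2l/lt_onaddr.
Qed.

Lemma onadd_closed_omega (z : Ord) : (0 < z)%O -> onadd_closed z -> onadd_closed (z * omega).
Proof.
move=> z0 cl a b /lt_omulP[_ /olt_omega[p ->] /(lt_oadd_ex z0)[a' az aa']].
move=> /lt_omulP[_ /olt_omega[q ->] /(lt_oadd_ex z0)[b' bz bb']].
apply: le_lt_trans (le_onaddl _ aa') _; apply: le_lt_trans (le_onaddr _ bb') _.
apply: le_lt_trans (onadd_mul_onat cl p q az bz) _.
apply: (@lt_le_trans _ _ (z * onat (p + q) + z)); first by apply/lt_oadd2l/cl.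
exact/lt_omul_le/lt_onat_omega.
Qed.

(** Two ordinals below ω^e both lie below ω^v·ω for a common v < e, and closure of ω^v passes to
    ω^v·ω. *)
Lemma onadd_closed_opow (e : Ord) : onadd_closed (ω^e).
Proof.
elim/ord_ind: e => e IH a b.
have key v : (v < e)%O -> (a < ω^v * omega)%O -> (b < ω^v * omega)%O -> (onadd a b < ω^e)%O.
  move=> ve av bv; apply: lt_le_trans (lt_opow_le ve).
  by apply: onadd_closed_omega => //; [apply: opow_gt0 | apply: IH].
have pos v : (0 < ω^v * omega)%O by apply: omul_gt0 (opow_gt0 _) (lt_onat_omega 0).
move=> /lt_opowP[a0|[v ve av]] /lt_opowP[b0|[w we bw]].
- rewrite a0 b0; apply: le_lt_trans (opow_gt0 e).
  by apply/onadd_leP; split=> u; rewrite oltx0.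
- by apply: (key w) => //; rewrite a0.
- by apply: (key v) => //; rewrite b0.
- have up x y : (x <= y)%O -> (ω^x * omega <= ω^y * omega)%O.
    by move=> xy; apply: le_omul => //; apply: le_opow.
  case: (leP v w) => vw.
    by apply: (key w) => //; apply: lt_le_trans av _; apply: up.
  by apply: (key v) => //; apply: lt_le_trans bw _; apply/up/ltW.
Qed.

(** * Uniqueness of Cantor normal forms *)

Lemma cnf_sumSl (e : nat -> Ord) m :
  cnf_sum e m.+1 = ω^(e 0%N) + cnf_sum (fun i => e i.+1) m.
Proof.
elim: m => [|m IH]; first by rewrite /= oadd0x oaddx0.
by rewrite /= oaddA -IH.
Qed.

Lemma cnf_sum_bound (e : nat -> Ord) x m :
  (forall i, (i < m)%N -> (e i <= x)%O) -> (cnf_sum e m < ω^(x + 1))%O.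
Proof.
move=> le; rewrite opowS.
have h : (cnf_sum e m <= ω^x * onat m)%O.
  elim: m le => [|m IH] le; first exact: ole0x.
  rewrite /= omulS; apply: le_oadd; last by apply/le_opow/le.
  by apply: IH => i im; apply: le; apply: ltnW.
by apply: le_lt_trans h _; apply: lt_omul2l (opow_gt0 _) (lt_onat_omega m).
Qed.

Definition antitone_upto (e : nat -> Ord) m :=
  forall p q : nat, (p <= q < m)%N -> (e q <= e p)%O.

(** The first exponent is determined, because the sum lies in the interval from ω^(e 0) to ω^(e 0 +
    1). Left cancellation of the first term reduces the length by one. *)
Lemma cnf_sum_inj m m' (e e' : nat -> Ord) :
  antitone_upto e m -> antitone_upto e' m' -> cnf_sum e m = cnf_sum e' m' ->
  m = m' /\ forall i, (i < m)%N -> e i = e' i.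
Proof.
elim: m m' e e' => [|m IH] [|m'] e e' an an' //.
- move=> /esym /= h; have := opow_gt0 (e' m').
  by rewrite ltNge => /negP; case; rewrite -h; apply: le_oaddl.
- move=> /= h; have := opow_gt0 (e m).
  by rewrite ltNge => /negP; case; rewrite -h; apply: le_oaddl.
move=> eq; have lead k e1 e2 k2 : antitone_upto e1 k.+1 -> cnf_sum e1 k.+1 = cnf_sum e2 k2.+1 ->
    (e2 0%N <= e1 0%N)%O.
  move=> an1 eq1; apply/olt_succ; apply: contrapT => /negP; rewrite -leNgt => le.
  have : (cnf_sum e1 k.+1 < ω^(e1 0%N + 1))%O by apply: cnf_sum_bound => i ik; apply: an1.
  rewrite eq1 cnf_sumSl ltNge => /negP; apply.
  by apply: le_trans (le_opow le) (le_oaddr _ _).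
have e0 : e 0%N = e' 0%N.
  by apply/eqP; rewrite eq_le (lead _ _ _ _ an' (esym eq)) (lead _ _ _ _ an eq).
move: eq; rewrite !cnf_sumSl e0 => /oadd_inj /IH[].
- by move=> p q pq; apply: an.
- by move=> p q pq; apply: an'.
by move=> -> h; split=> // -[|i] // /h.
Qed.

(** This turns uniqueness of the factorization of an indecomposable ordinal into uniqueness of the
    normal form of its exponent. *)
Lemma cnf_prodE (e : nat -> Ord) m : cnf_prod e m = ω^(cnf_sum e m).
Proof. by elim: m => [|m IH] /=; rewrite ?opow0 // opowD IH. Qed.

Lemma cnf_prod_inj m m' (e e' : nat -> Ord) :
  antitone_upto e m -> antitone_upto e' m' -> cnf_prod e m = cnf_prod e' m' ->
  m = m' /\ forall i, (i <= m)%N -> cnf_prod e i = cnf_prod e' i.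
Proof.
move=> an an'; rewrite !cnf_prodE => /opow_inj /(cnf_sum_inj an an')[mm h]; split=> // i.
by elim: i => //= i IH im; rewrite h // IH // ltnW.
Qed.

(** * Derivatives of subsets of a tree *)

Section Derivatives.
Context (d : Order.disp_t) (P : porderType d).
Implicit Types (A B D Q U V : set P) (s t q : P) (u x μ ν δ ξ : Ord).

Lemma derivE A t : deriv A t <-> A t /\ exists2 s, A s & (t < s)%O.
Proof.
split=> [[At nl]|[At [s As ts]]].
  split=> //; apply: contrapT => h; apply: nl; split=> // s As ts; apply: h; by exists s.
by split=> // -[_ /(_ s As)].
Qed.

Lemma derivs_anti A x y : (x <= y)%O -> derivs A y `<=` derivs A x.
Proof.
have [a ->] := ocls_surj x; have [b ->] := ocls_surj y.
by move=> /ole_cls ab; rewrite !derivs_cls; apply: tderivs_anti.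
Qed.

Lemma derivs_sub A x : derivs A x `<=` A.
Proof. by rewrite -{2}(derivs0 A); apply/derivs_anti/ole0x. Qed.

(** A single clause replaces those for zero, successors and limits. Only points above t occur in it,
    which is why derivatives are local to upward closed parts. *)
Lemma derivsP A ξ t : derivs A ξ t <->
  A t /\ forall u, (u < ξ)%O -> exists2 s, derivs A u s & (t < s)%O.
Proof.
split=> [h|].
  split=> [|u uξ]; first exact: derivs_sub h.
  have : derivs A (u + 1) t by apply: derivs_anti h; apply/oleS.
  by rewrite derivsS => /derivE[].
elim/ord_ind: ξ => ξ IH [At h]; have [a aE] := ocls_surj ξ.
rewrite aE derivs_cls; case: a aE => L f aE; split=> // i.
have lti : (ocls (f i) < ξ)%O by rewrite aE; apply/olt_cls/(@tlt_sub (Node f)).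
rewrite -derivs_cls; apply/derivE; split; last exact: h.
by apply: IH => //; split=> // u ui; apply: h; apply: lt_trans lti.
Qed.

Lemma derivs_down A ξ s t : A s -> (s < t)%O -> derivs A ξ t -> derivs A ξ s.
Proof.
move=> As st /derivsP[At h]; apply/derivsP; split=> // u /h[r Ar tr].
by exists r => //; apply: lt_trans tr.
Qed.

Lemma derivs_mono A B ξ : A `<=` B -> derivs A ξ `<=` derivs B ξ.
Proof.
move=> AB; elim/ord_ind: ξ => ξ IH t /derivsP[At h]; apply/derivsP; split; first exact: AB.
by move=> u uξ; have [s /(IH _ uξ) Bs ts] := h u uξ; exists s.
Qed.

Lemma derivs_add A μ x : derivs (derivs A μ) x = derivs A (μ + x).
Proof.
apply/seteqP; split=> t; elim/ord_ind: x t => x IH t /derivsP[At h].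
  apply/derivsP; split=> [|u /lt_oaddP[uμ|[v vx uv]]]; first exact: derivs_sub At.
    by have /derivsP[_] := At; apply.
  have [s As ts] := h v vx; exists s => //; apply: derivs_anti uv _ _; exact: IH.
apply/derivsP; split=> [|u ux].
  apply/derivsP; split=> // u uμ; apply: h; exact: lt_le_trans (le_oaddr _ _).
have [|s As ts] := h (μ + u); first exact: lt_oadd2l.
by exists s => //; apply: IH.
Qed.

(** * Upward closed subsets *)

Definition up_closed A U := U `<=` A /\ forall s t, U s -> (s < t)%O -> A t -> U t.

Lemma up_closed_refl A : up_closed A A.
Proof. by split. Qed.

Lemma derivs_up A U x t : up_closed A U -> U t -> derivs U x t <-> derivs A x t.
Proof.
move=> [UA up] Ut; split; first exact: derivs_mono.
elim/ord_ind: x t Ut => x IH t Ut /derivsP[At h]; apply/derivsP; split=> // u ux.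
have [s As ts] := h u ux; exists s => //; apply: IH => //.
by apply: up ts _ => //; apply: derivs_sub As.
Qed.

Lemma up_closed_trans A U V : up_closed A U -> up_closed U V -> up_closed A V.
Proof.
move=> [UA upU] [VU upV]; split=> [|s t Vs st At]; first exact: subset_trans UA.
by apply: (upV s) => //; apply: (upU s) => //; apply: VU.
Qed.

(** Derivatives strip a tree from its leaves, so this is the upper part of [A]: the points removed
    before stage μ. *)
Definition trim A μ := A `\` derivs A μ.
Definition above A q : set P := [set t | A t /\ (q < t)%O].

Lemma trim_up A μ : up_closed A (trim A μ).
Proof.
split=> [t []//|s t [As nAs] st At]; split=> // h; apply: nAs.
exact: derivs_down h.
Qed.

Lemma above_up A q : up_closed A (above A q).
Proof. by split=> [t []|s t [As qs] st At] //; split=> //; apply: lt_trans st. Qed.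

Lemma above_up_closed U V q : up_closed U V -> V q -> above V q = above U q.
Proof.
move=> [VU up] Vq; apply/seteqP; split=> t [At qt]; split=> //; first exact: VU.
exact: up qt At.
Qed.

Lemma trim_up_closed U V μ : up_closed U V -> up_closed (trim U μ) (trim V μ).
Proof.
move=> up; split=> [t [Vt nt]|s t [Vs ns] st [Ut nt]].
  by split; [apply: up.1 | move=> /(derivs_up _ up Vt)].
have Vt : V t by apply: up.2 st Ut.
by split=> // /(derivs_up _ up Vt).
Qed.

Lemma derivs_up_closed U V μ : up_closed U V -> up_closed (derivs U μ) (derivs V μ).
Proof.
move=> up; split=> [|s t Vs st Ut]; first exact/derivs_mono/up.1.
apply/(derivs_up _ up) => //; apply: up.2 st _; first exact: derivs_sub Vs.
exact: derivs_sub Ut.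
Qed.

Lemma above_above A s t : (s < t)%O -> above (above A s) t = above A t.
Proof.
move=> st; apply/seteqP; split=> r [] => [[]|] // Ar tr.
by split=> //; split=> //; apply: lt_trans tr.
Qed.

Lemma trim_empty A μ : derivs (trim A μ) μ = set0.
Proof.
rewrite -subset0 => t h; have [At nAt] := derivs_sub h.
by apply: nAt; apply: derivs_mono h => r [].
Qed.

Lemma layerE A (e : nat -> Ord) i : layer A e i = trim (derivs A (cnf_sum e i)) (ω^(e i)).
Proof. by rewrite /trim derivs_add. Qed.

(** * Lower bounds on the rank *)

Definition rank_ge A μ := forall u, (u < μ)%O -> derivs A u !=set0.
Definition ranked A μ := rank_ge A μ /\ derivs A μ = set0.

Lemma rank_ge_le A μ ν : (μ <= ν)%O -> rank_ge A ν -> rank_ge A μ.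
Proof. by move=> le h u uμ; apply: h; apply: lt_le_trans le. Qed.

Lemma rank_ge_mono A B μ : A `<=` B -> rank_ge A μ -> rank_ge B μ.
Proof. by move=> AB h u /h[t At]; exists t; apply: derivs_mono At. Qed.

(** Emptiness of the derivative passes to subsets, so for the sets constructed below only [rank_ge]
    has to be proved. *)
Lemma ranked_sub A Q μ : Q `<=` A -> ranked A μ -> rank_ge Q μ -> ranked Q μ.
Proof. by move=> QA [_ A0] geQ; split=> //; rewrite -subset0 -A0; apply: derivs_mono. Qed.

Lemma rank_ge_derivs A μ ν : rank_ge A (μ + ν) -> rank_ge (derivs A μ) ν.
Proof. by move=> h u uν; rewrite derivs_add; apply: h; apply: lt_oadd2l. Qed.

Lemma rank_geD A μ ν : (0 < ν)%O -> rank_ge (derivs A μ) ν -> rank_ge A (μ + ν).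
Proof.
move=> ν0 h u /(lt_oadd_ex ν0)[v vν uv]; have [t] := h v vν.
by rewrite derivs_add => At; exists t; apply: derivs_anti At.
Qed.

Lemma rank_ge_above A q μ : derivs A μ q -> rank_ge (above A q) μ.
Proof.
move=> /derivsP[Aq h] u /h[s As qs]; exists s; apply/(derivs_up _ (above_up A q)) => //.
by split=> //; apply: derivs_sub As.
Qed.

(** The value 0 is excluded because [rank] also takes it by default, when no derivative is empty. *)
Lemma rankP A μ : μ <> 0 -> rank A = μ <-> ranked A μ.
Proof.
move=> μ0; have min_uniq (S : set Ord) x y : S x -> (forall y, S y -> (x <= y)%O) ->
    S y -> (forall z, S z -> (y <= z)%O) -> x = y.
  by move=> Sx mx Sy my; apply/eqP; rewrite eq_le mx // my.
have ranked_min : ranked A μ -> forall y, derivs A y = set0 -> (μ <= y)%O.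
  by move=> [ge _] y y0; rewrite leNgt; apply/negP => /ge [t]; rewrite y0.
split=> [rk|rk]; last first.
  have [] := @ominP [set ξ | derivs A ξ = set0] (ex_intro _ μ rk.2).
  by move=> S1 S2; apply: (min_uniq [set ξ | derivs A ξ = set0]) => //; [case: rk | apply: ranked_min].
have ne : [set ξ | derivs A ξ = set0] !=set0.
  apply: contrapT => h; apply: μ0; rewrite -rk /rank /omin; case: xgetP => //.
  by move=> x _ [Sx _]; case: h; exists x.
have [S1 S2] := ominP ne; move: S1 S2; rewrite -/(rank A) rk => S1 S2.
split=> // u uμ; apply/set0P/eqP => u0; have := S2 u u0.
by rewrite leNgt uμ.
Qed.

(* [A] separates s from t at scale δ: for s < t, this says that τ_{A,δ}(s) and
   τ_{A,δ}(t) differ. *)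
Definition sep A δ s t := exists2 x, derivs A (δ * x) s & ~ derivs A (δ * x) t.

(** At a scale δ that exhausts [A], every point has height 0. *)
Lemma sep_ranked A δ s t : A t -> derivs A δ = set0 -> ~ sep A δ s t.
Proof.
move=> At A0 [x]; have [->|/olt0x x0] := pselect (x = 0).
  by rewrite omulx0 derivs0.
by move=> /(derivs_anti (le_omulr δ x0)); rewrite A0.
Qed.

(** Passing to A^(δ·ν) cancels ν on the left of all heights at scale δ, so equal heights stay equal
    and distinct ones stay distinct. Levels x < ν separate no points of [D], since [D] lies in
    A^(δ·x). *)
Lemma sep_shift A D δ ν s t : up_closed (derivs A (δ * ν)) D -> D s -> D t ->
  sep D δ s t <-> sep A δ s t.
Proof.
move=> up Ds Dt; have eqd x r : D r -> derivs D (δ * x) r <-> derivs A (δ * (ν + x)) r.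
  by move=> Dr; rewrite omulDr -derivs_add; apply: derivs_up.
split=> -[x].
  by move=> /eqd h1 h2; exists (ν + x); [apply: h1 | move=> /eqd h; apply/h2/h].
have [νx|/ltW xν] := leP ν x.
  have [w ->] := le_oadd_ex νx => h1 h2.
  by exists w; [apply/eqd | move=> /eqd h; apply/h2/h].
move=> _ []; apply: derivs_anti (up.1 _ Dt); exact: le_omul.
Qed.

(** * Well-founded trees *)

Hypothesis P_wf : forall A, A !=set0 -> exists2 m, A m & forall s, A s -> ~ (m < s)%O.
Hypothesis P_tree : is_tree P.

Lemma max_above A t : A t -> exists2 m, (t <= m)%O & A m /\ forall s, A s -> ~ (m < s)%O.
Proof.
move=> At; have [|m [Am tm] mm] := @P_wf [set s | A s /\ (t <= s)%O].
  by exists t.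
exists m => //; split=> // s As ms; apply: (mm s) => //; split=> //.
exact: le_trans (ltW ms).
Qed.

Lemma min_below A t : A t -> exists2 m, (m <= t)%O & A m /\ forall s, A s -> ~ (s < m)%O.
Proof.
move=> At; have [||m [Am mt] mm] := @P_tree t [set s | A s /\ (s <= t)%O].
- by move=> s [].
- by exists t.
exists m => //; split=> // s As sm; have /mm : A s /\ (s <= t)%O.
  by split=> //; apply: le_trans (ltW sm) mt.
by move=> ms; have := lt_le_trans sm ms; rewrite ltxx.
Qed.

Lemma tree_comparable s t r : (s <= r)%O -> (t <= r)%O -> (s <= t)%O \/ (t <= s)%O.
Proof.
move=> sr tr; have [||m mm le] := @P_tree r [set s' | s' = s \/ s' = t].
- by move=> _ [] ->.
- by exists s; left.
by case: mm le => -> le; [left; apply: le; right | right; apply: le; left].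
Qed.

(** If A^μ is inhabited, a maximal point of it has points of every A^u with u < μ above it, and by
    maximality these are outside A^μ. *)
Lemma rank_ge_trim A μ : rank_ge A μ -> rank_ge (trim A μ) μ.
Proof.
move=> ge u uμ; have [t At] := ge u uμ.
have [s As ns] : exists2 s, derivs A u s & ~ derivs A μ s.
  have [h|] := pselect (derivs A μ t); last by exists t.
  have [m _ [Am mm]] := max_above h; have /derivsP[_ /(_ u uμ)[s As ms]] := Am.
  by exists s => // /mm.
exists s; apply/(derivs_up _ (trim_up A μ)) => //; split=> //; exact: derivs_sub As.
Qed.

Lemma ranked_trim A μ : rank_ge A μ -> ranked (trim A μ) μ.
Proof. by move=> ge; split; [apply: rank_ge_trim | apply: trim_empty]. Qed.

(** * Gluing pieces above an antichain or above maximal points *)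

Section Glue.
Variables (B I : set P) (R : P -> set P).
Hypothesis I_antichain : forall q q', I q -> I q' -> ~ (q < q')%O.
Hypothesis R_above : forall q t, I q -> R q t -> (q < t)%O.
Hypothesis B_below : forall q t, I q -> B t -> ~ (q < t)%O.

Definition glue : set P := [set t | B t \/ exists2 q, I q & R q t].

(** A point of [R q'] above a point of [R q] has both q and q' below it. In a tree these are
    comparable, hence equal in the antichain. *)
Lemma glue_up q : I q -> up_closed glue (R q).
Proof.
move=> Iq; split=> [t Rt|s t Rs st]; first by right; exists q.
have qt := lt_trans (R_above Iq Rs) st; move=> [Bt|[q' Iq' Rt]].
  by case: (B_below Iq Bt).
suff -> : q = q' by [].
have q't := R_above Iq' Rt.
have [|] := tree_comparable (ltW qt) (ltW q't); rewrite le_eqVlt => /orP[/eqP //|].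
  by move=> h; case: (I_antichain Iq Iq').
by move=> h; case: (I_antichain Iq' Iq).
Qed.

End Glue.

Definition maxs B : set P := [set q | B q /\ forall s, B s -> ~ (q < s)%O].

Definition stack B R := glue B (maxs B) R.

Section Stack.
Variables (B : set P) (R : P -> set P) (μ : Ord).
Hypothesis R_above : forall q t, maxs B q -> R q t -> (q < t)%O.

Lemma stack_up q : maxs B q -> up_closed (stack B R) (R q).
Proof.
apply: glue_up => // q1 t.
  by move=> [_ h1] [h2 _]; apply: h1.
by move=> [_ h] Bt; apply: h.
Qed.

Lemma stack_above q s t : maxs B q -> R q s -> stack B R t -> (s < t)%O -> R q t.
Proof. by move=> /stack_up[_ h] Rs St st; apply: h st St. Qed.

Hypothesis R_ranked : forall q, maxs B q -> ranked (R q) μ.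

(** Each piece [R q] is upward closed and vanishes at stage μ, while every point of [B] lies below a
    maximal one, which carries a piece of rank μ. *)
Lemma stack_derivs : derivs (stack B R) μ = B.
Proof.
apply/seteqP; split=> t.
  move=> h; have [//|[q Bq Rt]] := derivs_sub h.
  have /(derivs_up _ (stack_up Bq) Rt) := h.
  by have [_ ->] := R_ranked Bq.
move=> Bt; have [q tq Bq] := max_above Bt; apply/derivsP; split=> [|u uμ]; first by left.
have [s Rs] := (R_ranked Bq).1 u uμ; have Rqs := derivs_sub Rs.
exists s; first by apply/(derivs_up _ (stack_up Bq) Rqs).
exact: le_lt_trans tq (R_above Bq Rqs).
Qed.

End Stack.

(** * Homogeneous subsets of a tree of indecomposable rank *)

(** By [tau_sep] below, for ranked sets this is agreement on which pairs have equal τ at scale δ. *)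
Definition keeps δ Q U := Q `<=` U /\
  forall s t, Q s -> Q t -> (s < t)%O -> sep Q δ s t <-> sep U δ s t.

Lemma keeps_trans δ Q U V : keeps δ Q U -> keeps δ U V -> keeps δ Q V.
Proof.
move=> [QU h1] [UV h2]; split=> [|s t Qs Qt st]; first exact: subset_trans UV.
by apply: (iff_trans (h1 _ _ Qs Qt st)); apply: h2 st; apply: QU.
Qed.

Lemma keeps_shift δ ν D A : up_closed (derivs A (δ * ν)) D -> keeps δ D A.
Proof.
move=> up; split=> [|s t Ds Dt _]; last exact: sep_shift up Ds Dt.
by apply: subset_trans up.1 _; apply: derivs_sub.
Qed.

Lemma keeps_up δ D A : up_closed A D -> keeps δ D A.
Proof. by move=> up; apply: (@keeps_shift δ 0); rewrite omulx0 derivs0. Qed.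

Fixpoint bprod (b : nat -> Ord) (i : nat) : Ord :=
  if i is j.+1 then bprod b j * ω^(b j) else 1.

Lemma bprod_gt0 b i : (0 < bprod b i)%O.
Proof. by elim: i => [|i IH] /=; [apply: olt0_1 | apply: omul_gt0 IH (opow_gt0 _)]. Qed.

Lemma bprod_dvd b i n : (i <= n)%N -> exists κ, bprod b n = bprod b i * κ.
Proof.
move=> /subnKC <-; elim: (n - i)%N => [|k [κ IH]]; first by exists 1; rewrite addn0 omulx1.
by exists (κ * ω^(b (i + k)%N)); rewrite addnS /= IH omulA.
Qed.

(** * Adding one factor ω^b to the rank *)

Section ProductStep.
Variables (b : nat -> Ord) (n : nat).
Let α := bprod b n.

Definition keeps_upto m Q U := forall i, (i <= m)%N -> keeps (bprod b i) Q U.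

Lemma keeps_upto_sub m Q U : keeps_upto m Q U -> Q `<=` U.
Proof. by move=> /(_ 0%N isT)[]. Qed.

Definition block U ζ := trim (derivs U (α * ζ)) α.

Lemma block_up U ζ : up_closed (derivs U (α * ζ)) (block U ζ).
Proof. exact: trim_up. Qed.

(** Each partial product divides α on the left, so a shift by α·ζ is a shift by a multiple of every
    scale considered. *)
Lemma keeps_shift_α ζ D A : up_closed (derivs A (α * ζ)) D -> keeps_upto n D A.
Proof.
move=> up i /(bprod_dvd b)[κ ακ]; apply: (@keeps_shift _ (κ * ζ)).
by rewrite omulA -ακ.
Qed.

Hypothesis homogeneous : forall U (C : set P), ranked U α ->
  exists Q, [/\ keeps_upto n Q U, rank_ge Q α & Q `<=` C \/ Q `<=` ~` C].

(* [big C ξ U]: a subset of [C] of rank α·ξ that respects the separation of [U]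
   can be assembled from the top by stacking blocks of rank α. *)
Inductive big (C : set P) (ξ : Ord) (U : set P) : Prop :=
  Big of (forall x, (x < ξ)%O -> exists Q ζ,
    [/\ keeps_upto n Q (block U ζ), rank_ge Q α, Q `<=` C &
        forall q, Q q -> big C x (trim (above U q) (α * ζ))]).

Lemma bigP C ξ U : big C ξ U -> forall x, (x < ξ)%O -> exists Q ζ,
    [/\ keeps_upto n Q (block U ζ), rank_ge Q α, Q `<=` C &
        forall q, Q q -> big C x (trim (above U q) (α * ζ))].
Proof. by case. Qed.

Lemma big_le C x y U : (x <= y)%O -> big C y U -> big C x U.
Proof. by move=> xy [h]; split=> z zx; apply: h; apply: lt_le_trans xy. Qed.

Lemma big_succs C ξ U : (forall x, (x < ξ)%O -> big C (x + 1) U) -> big C ξ U.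
Proof. by move=> h; split=> x /h[]; apply; apply: ltoS. Qed.

Lemma keeps_upto_trans m Q U V : keeps_upto m Q U -> keeps_upto m U V -> keeps_upto m Q V.
Proof. by move=> h1 h2 i im; apply: keeps_trans (h1 i im) (h2 i im). Qed.

Lemma keeps_upto_up m U V : up_closed U V -> keeps_upto m V U.
Proof. by move=> up i _; apply: keeps_up. Qed.

Lemma big_up C ξ U V : up_closed U V -> big C ξ V -> big C ξ U.
Proof.
move=> up [h]; split=> x /h[Q [ζ [h1 h2 h3 h4]]]; exists Q, ζ; split=> //.
  apply: keeps_upto_trans h1 _; apply: keeps_upto_up.
  exact/trim_up_closed/derivs_up_closed.
move=> q Qq; rewrite -(above_up_closed up); first exact: h4.
by have [/derivs_sub] := keeps_upto_sub h1 Qq.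
Qed.

(** A double induction on x and y stands in for the maximal heights g_c. For x' < x and y' < y both
    x' ⊕ y and x ⊕ y' are below N, so the rank α·N left above a point of block N suffices for the
    induction hypotheses. *)
Lemma big_split (C : set P) x y U : rank_ge U (α * (onadd x y + 1)) ->
  big C (x + 1) U \/ big (~` C) (y + 1) U.
Proof.
elim/ord_ind: x y U => x IHx y; elim/ord_ind: y => y IHy U; set N := onadd x y => ge.
have geD : rank_ge (derivs U (α * N)) α by apply: rank_ge_derivs; rewrite -omulS.
have [Q [kQ geQ QC]] := homogeneous C (ranked_trim geD).
pose W q := trim (above U q) (α * N).
have geW q : Q q -> rank_ge (W q) (α * N).
  by move=> /(keeps_upto_sub kQ)[Uq _]; apply: rank_ge_trim; apply: rank_ge_above.
have W_up q : up_closed U (W q).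
  exact: up_closed_trans (above_up U q) (trim_up _ _).
(* If one of the two goals is already reached above some q, it passes to [U]. Otherwise heights x
   and y are both available above every q, and the colour of [Q] decides which of them grows by
   one. *)
have [[q [Qq]]|none] := pselect (exists q, Q q /\ (big C (x + 1) (W q) \/ big (~` C) (y + 1) (W q))).
  by move=> [] /(big_up (W_up q)); [left | right].
have bigx q : Q q -> big C x (W q).
  move=> Qq; apply: big_succs => x' x'x; have [|//|h] := IHx x' x'x y (W q).
    by apply: rank_ge_le (geW q Qq); apply: le_omul => //; apply/oleS/lt_onaddl.
  by case: none; exists q; split=> //; right.
have bigy q : Q q -> big (~` C) y (W q).
  move=> Qq; apply: big_succs => y' y'y; have [|h|//] := IHy y' y'y (W q).
    by apply: rank_ge_le (geW q Qq); apply: le_omul => //; apply/oleS/lt_onaddr.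
  by case: none; exists q; split=> //; left.
case: QC => QC; [left | right]; split=> z /olt_succ zle; exists Q, N; split=> //.
  by move=> q /bigx; apply: big_le.
by move=> q /bigy; apply: big_le.
Qed.

Lemma big_assembleS (C : set P) x U Q' ζ (R0 : P -> set P) :
    keeps_upto n Q' (block U ζ) -> rank_ge Q' α -> Q' `<=` C ->
    (forall q, Q' q -> [/\ R0 q `<=` C, rank_ge (R0 q) (α * x) &
       keeps_upto n (R0 q) (trim (above U q) (α * ζ))]) ->
  exists Q, [/\ Q `<=` C, rank_ge Q (α * (x + 1)) & keeps_upto n Q U].
Proof.
(* Trimming gives the pieces rank exactly α·x, so that [Q'] is recovered as a derivative of the
   stack. *)
move=> kQ' geQ' Q'C hR0; pose R q := trim (R0 q) (α * x); pose Q := stack Q' R.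
have hR q : Q' q -> [/\ R q `<=` C, ranked (R q) (α * x) & keeps_upto n (R q) (trim (above U q) (α * ζ))].
  move=> /hR0[h1 h2 h3]; split; [by move=> t [/h1] | exact: ranked_trim |].
  by apply: keeps_upto_trans h3; apply: keeps_upto_up; apply: trim_up.
have Q'blk := keeps_upto_sub kQ'.
have RU q t : maxs Q' q -> R q t -> trim (above U q) (α * ζ) t.
  by move=> [/hR[_ _ /keeps_upto_sub h] _] /h.
have R_above q t : maxs Q' q -> R q t -> (q < t)%O by move=> Mq /(RU _ _ Mq)[[]].
have Rrk q : maxs Q' q -> ranked (R q) (α * x) by move=> [/hR[]].
have dQ : derivs Q (α * x) = Q' := stack_derivs R_above Rrk.
exists Q; split.
- by move=> t [/Q'C //|[q [/hR[h _ _] _] /h]].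
- by rewrite omulS; apply: rank_geD (bprod_gt0 _ _) _; rewrite dQ.
have Q'U t : Q' t -> derivs U (α * ζ) t by move=> /Q'blk[].
have nU q t : maxs Q' q -> R q t -> ~ derivs U (α * ζ) t.
  move=> Mq /(RU _ _ Mq)[At nAt] Ut; apply: nAt.
  exact/(derivs_up _ (above_up U q) At).
move=> i iN; split=> [t [/Q'U/derivs_sub //|[q Mq /(RU _ _ Mq)[[]] //]]|].
move=> s t Qs Qt st; case: (Qs) => [Q's|[q Mq Rs]].
  case: (Qt) => [Q't|[q Mq Rt]].
    have up1 : up_closed (derivs Q (α * x)) Q' by rewrite dQ; split.
    have [_ /(_ s t Q's Q't st) <-] := keeps_shift_α up1 iN.
    have [_ /(_ s t Q's Q't st) ->] := kQ' i iN.
    have [_ h] := keeps_shift_α (block_up U ζ) iN.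
    by apply: h => //; apply: Q'blk.
  (* For s in the bottom block and t in a piece, the pair is separated on both sides: in [U] at
     level α·ζ and in [Q] at level α·x. Both levels are multiples of the scale. *)
  have [κ ακ] := bprod_dvd b iN.
  split=> _; [exists (κ * ζ) | exists (κ * x)]; rewrite omulA -ακ -/α.
  - exact: Q'U.
  - exact: nU Mq Rt.
  - by rewrite dQ.
  - by rewrite dQ => /Q'U; apply: nU Mq Rt.
have Rt := stack_above R_above Mq Rs Qt st.
have [_ /(_ s t Rs Rt st) <-] := keeps_up (bprod b i) (stack_up R_above Mq).
have [_ _ /(_ i iN)[_ /(_ s t Rs Rt st) ->]] := hR q Mq.1.
have [_ h] := keeps_up (bprod b i) (up_closed_trans (above_up U q) (trim_up _ (α * ζ))).
by apply: h => //; apply: RU Mq _.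
Qed.

Lemma big_assemble (C : set P) ξ U : big C ξ U ->
  exists Q, [/\ Q `<=` C, rank_ge Q (α * ξ) & keeps_upto n Q U].
Proof.
elim/ord_ind: ξ U => ξ IH U0 big0.
(* Pass to the part above a maximal point above which height ξ is available, if there is such a
   point. Then [U] has height ξ, but the part above any of its points does not. *)
have [U [up bigU maxU]] : exists U, [/\ up_closed U0 U, big C ξ U &
    forall t, U t -> ~ big C ξ (above U t)].
  have [[t [Ut bt]]|none] := pselect (exists t, U0 t /\ big C ξ (above U0 t)); last first.
    exists U0; split=> //; first exact: up_closed_refl.
    by move=> t Ut bt; apply: none; exists t.
  have [|m [Um bm] mm] := @P_wf [set t | U0 t /\ big C ξ (above U0 t)]; first by exists t.
  exists (above U0 m); split=> //; first exact: above_up.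
  by move=> s [Us ms]; rewrite above_above // => bs; apply: (mm s).
suff [Q [h1 h2 h3]] : exists Q, [/\ Q `<=` C, rank_ge Q (α * ξ) & keeps_upto n Q U].
  by exists Q; split=> //; apply: keeps_upto_trans h3 (@keeps_upto_up _ _ _ up).
have [ξ0|[x ξx]|lim] := succ_or_limit ξ.
- exists set0; split=> //; rewrite ?ξ0 ?omulx0; first by move=> u; rewrite oltx0.
  by move=> i _; split=> //.
- have xξ : (x < ξ)%O by rewrite ξx; apply: ltoS.
  have [Q' [ζ [h1 h2 h3 h4]]] := bigP bigU xξ.
  have /choice[R0 hR0] : forall q, exists R, Q' q -> [/\ R `<=` C, rank_ge R (α * x) &
      keeps_upto n R (trim (above U q) (α * ζ))].
    move=> q; have [Qq|nQq] := pselect (Q' q); last by exists set0.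
    by have [R hR] := IH x xξ _ (h4 q Qq); exists R.
  by rewrite ξx; apply: big_assembleS h1 h2 h3 hR0.
(* In the limit case, pieces are glued above the minimal points of [U]. *)
pose M : set P := [set r | U r /\ forall s, U s -> ~ (s < r)%O].
have /choice[R hR] : forall r, exists R, M r ->
    [/\ R `<=` C, keeps_upto n R (above U r) &
        forall x, big C x (above U r) -> rank_ge R (α * x)].
  move=> r; have [[Ur _]|nMr] := pselect (M r); last by exists set0.
  have [|y nby ymin] := @omin_ex (fun y => ~ big C y (above U r)).
    by exists ξ; apply: maxU.
  have [x xy bx] : exists2 x, (x < y)%O & ~ big C (x + 1) (above U r).
    apply: contrapT => h; apply/nby/big_succs => x xy.
    by apply: contrapT => nb; apply: h; exists x.
  have xξ : (x < ξ)%O.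
    apply: lt_le_trans xy _; rewrite leNgt; apply/negP => /ymin; apply; exact: maxU.
  have bigx : big C x (above U r) by apply: contrapT; apply: ymin.
  have [R [h1 h2 h3]] := IH x xξ _ bigx.
  exists R => _; split=> // z bz; apply: rank_ge_le h2; apply: le_omul => //.
  by rewrite leNgt; apply/negP => /oleS xz; apply: bx; apply: big_le bz.
pose Q := glue set0 M R.
have RU r t : M r -> R r t -> above U r t by move=> /hR[_ /keeps_upto_sub h _] /h.
have Rup r : M r -> up_closed Q (R r).
  apply: glue_up => //.
    by move=> q q' [Uq _] [_ h]; apply: h.
  by move=> q t Mq /(RU _ _ Mq)[].
exists Q; split.
- by move=> t [//|[r /hR[h _ _] /h]].
- move=> u /(lt_omul_lim lim)[x xξ ux].
  (* Some q in [U] has height x available above it. So has the minimal point r below q, because the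
     part above q is upward closed in the part above r; the piece at r thus has rank at least
     α·x. *)
  have [Q' [ζ [h1 h2 _ h4]]] := bigP bigU xξ.
  have [q Q'q] := h2 0 (bprod_gt0 _ _).
  have {}Q'q := derivs_sub Q'q; have [/derivs_sub Uq _] := keeps_upto_sub h1 Q'q.
  have [r rq Mr] := min_below Uq; have [_ _ /(_ x) geR] := hR r Mr.
  apply: (@rank_ge_mono (R r) Q (α * x)) => //; first by have [] := Rup r Mr.
  apply: geR; apply: big_up (h4 q Q'q); apply: up_closed_trans (trim_up _ _).
  split=> [t [Ut qt]|s t [_ qs] st [Ut _]]; split=> //; first exact: le_lt_trans qt.
  exact: lt_trans st.
move=> i iN; split=> [t [//|[r Mr /(RU _ _ Mr)[]] //]|].
move=> s t [//|[r Mr Rs]] Qt st; have Rt := (Rup r Mr).2 _ _ Rs st Qt.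
have [_ /(_ s t Rs Rt st) <-] := keeps_up (bprod b i) (Rup r Mr).
have [_ /(_ i iN)[_ /(_ s t Rs Rt st) ->] _] := hR r Mr.
by have [_ h] := keeps_up (bprod b i) (above_up U r); apply: h => //; apply: RU Mr _.
Qed.

Lemma homogeneousS U (C : set P) : ranked U (bprod b n.+1) ->
  exists Q, [/\ keeps_upto n.+1 Q U, rank_ge Q (bprod b n.+1) & Q `<=` C \/ Q `<=` ~` C].
Proof.
move=> rkU; set β := ω^(b n); have [geU U0] := rkU; rewrite /= -/β -/α in geU U0.
have : big C β U \/ big (~` C) β U.
  apply: contrapT => /not_orP[nC nC'].
  (* If both colours fail, they fail at some x + 1 and y + 1 with x, y < β. As β is closed under ⊕,
     the rank α·β is at least α·(x ⊕ y + 1), against [big_split]. *)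
  have ex D : ~ big D β U -> exists2 x, (x < β)%O & ~ big D (x + 1) U.
    move=> nD; apply: contrapT => h; apply/nD/big_succs => x xβ.
    by apply: contrapT => nb; apply: h; exists x.
  have [x xβ bx] := ex _ nC; have [y yβ by_] := ex _ nC'.
  have [|//|//] := @big_split C x y U.
  apply: rank_ge_le geU; apply: le_omul => //; apply/oleS.
  exact: onadd_closed_opow.
have fin D : big D β U -> exists Q, [/\ keeps_upto n.+1 Q U, rank_ge Q (bprod b n.+1) & Q `<=` D].
  move=> /big_assemble[Q [QD geQ kQ]]; exists Q; split=> // i; rewrite leq_eqVlt => /orP[/eqP ->|].
    (* The new scale equals the rank of both sets, so neither separates any pair. *)
    have QU := keeps_upto_sub kQ; split=> // s t Qs Qt st.
    have [_ Q0] := ranked_sub QU rkU geQ.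
    by split=> h; [case: (sep_ranked Qt Q0 h) | case: (sep_ranked (QU _ Qt) U0 h)].
  by rewrite ltnS; apply: kQ.
by move=> [] /fin[Q [h1 h2 h3]]; exists Q; split=> //; [left | right].
Qed.

End ProductStep.

Lemma homogeneous_subset b n U (C : set P) : ranked U (bprod b n) ->
  exists Q, [/\ keeps_upto b n Q U, rank_ge Q (bprod b n) & Q `<=` C \/ Q `<=` ~` C].
Proof.
elim: n U C => [|n IH] U C; last exact: homogeneousS.
move=> [geU U0]; have [t] := geU 0 olt0_1; rewrite derivs0 => Ut.
exists [set t]; split.
- move=> i; rewrite leqn0 => /eqP ->; split=> [s ->//|_ _ -> ->]; by rewrite ltxx.
- by move=> u /olt1 ->; exists t; rewrite derivs0.
- by have [Ct|nCt] := pselect (C t); [left | right] => s ->.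
Qed.

(** Each two-colour step, one colour against all others, either finishes or removes a colour from
    the list. *)
Lemma monochromatic_subset (K : eqType) (f : P -> K) b n U (c : seq K) :
  ranked U (bprod b n) -> (forall t, U t -> f t \in c) ->
  exists Q k, [/\ keeps_upto b n Q U, rank_ge Q (bprod b n) & forall t, Q t -> f t = k].
Proof.
elim: c U => [|k c IH] U rkU col.
  have [t /derivs_sub Ut] := rkU.1 0 (bprod_gt0 _ _).
  by have := col t Ut.
have [Q [kQ geQ QC]] := homogeneous_subset [set t | f t = k] rkU.
case: QC => QC; first by exists Q, k; split.
have [||Q' [k' [kQ' geQ' h]]] := IH Q.
- exact: ranked_sub (keeps_upto_sub kQ) rkU geQ.
- move=> t Qt; have := col t (keeps_upto_sub kQ Qt).
  by rewrite inE => /orP[/eqP /(QC t Qt)|].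
- exists Q', k'; split=> //; exact: keeps_upto_trans kQ' kQ.
Qed.

(** * Layers and their separations *)

Lemma bprod_cnf (η : nat -> Ord) i : bprod (fun j => ω^(η j)) i = cnf_prod η i.
Proof. by elim: i => //= i ->. Qed.

(** Like [is_separation], this ranges over all factorizations; by [cnf_prod_inj] they have the same
    partial products. *)
Definition keeps_cnf ξ Q U := Q `<=` U /\ forall (η : nat -> Ord) m i,
  antitone_upto η m -> ω^ξ = cnf_prod η m -> (i <= m)%N -> keeps (cnf_prod η i) Q U.

Lemma monochromatic_opow (K : eqType) (f : P -> K) ξ U (c : seq K) :
  ranked U (ω^ξ) -> (forall t, U t -> f t \in c) ->
  exists Q k, [/\ keeps_cnf ξ Q U, rank_ge Q (ω^ξ) & forall t, Q t -> f t = k].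
Proof.
move=> rkU col.
have [[η [m [an e]]]|none] := pselect (exists η m, antitone_upto η m /\ ω^ξ = cnf_prod η m).
  rewrite e -bprod_cnf in rkU *; have [Q [k [kQ geQ fk]]] := monochromatic_subset rkU col.
  exists Q, k; split=> //; split=> [|η' m' i an']; first exact: keeps_upto_sub kQ.
  rewrite e => e'; have [<- h] := cnf_prod_inj an an' e' => im.
  by rewrite -h // -bprod_cnf; apply: kQ.
(* In this branch the condition on factorizations is vacuous, and ω^ξ is treated as a single
   factor. *)
have e : bprod (fun=> ξ) 1 = ω^ξ by rewrite /= omul1x.
rewrite -e in rkU *; have [Q [k [kQ geQ fk]]] := monochromatic_subset rkU col.
exists Q, k; split=> //; split=> [|η m i an em _]; first exact: keeps_upto_sub kQ.
by case: none; exists η, m; split=> //; rewrite -e.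
Qed.

(** * Stacking the layers *)

Lemma layer_sub A (e : nat -> Ord) i : layer A e i `<=` A.
Proof. by move=> t [/derivs_sub]. Qed.

Lemma layer_up U V (e : nat -> Ord) i t :
  up_closed U V -> V t -> layer V e i t <-> layer U e i t.
Proof.
move=> up Vt; split=> -[h1 h2]; split.
- exact/(derivs_up _ up Vt).
- by move=> /(derivs_up _ up Vt).
- exact/(derivs_up _ up Vt).
- by move=> /(derivs_up _ up Vt).
Qed.

Lemma layer_up_closed U V (e : nat -> Ord) i :
  up_closed U V -> up_closed (layer U e i) (layer V e i).
Proof.
move=> up; split=> [t h|s t /layer_sub Vs st Ut].
  by apply/(layer_up _ _ up) => //; apply: layer_sub h.
have Vt : V t by apply: up.2 st (layer_sub Ut).
exact/(layer_up _ _ up).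
Qed.

Lemma cnf_sum_le (e : nat -> Ord) i j : (i <= j)%N -> (cnf_sum e i <= cnf_sum e j)%O.
Proof.
move=> /subnKC <-; elim: (j - i)%N => [|k IH]; rewrite ?addn0 // addnS.
exact: le_trans IH (le_oaddr _ _).
Qed.

(** Layers are numbered from the top, so the induction on their number splits off the lowest one,
    A^μ. Layers and separations found in [W q] transfer to [A] and [Q], as [W q] is upward closed in
    [A] and each piece [R q] used is upward closed in [Q]. *)
Lemma layered_subset (K : finType) (k0 : K) (f : P -> K) (e : nat -> Ord) l A :
  ranked A (cnf_sum e l) -> exists Q (F : nat -> K),
  [/\ Q `<=` A, rank_ge Q (cnf_sum e l) & forall i, (i < l)%N ->
    [/\ layer Q e i = Q `&` layer A e i,
        keeps_cnf (e i) (layer Q e i) (layer A e i) &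
        forall t, layer Q e i t -> f t = F i]].
Proof.
elim: l A => [|l IH] A [geA A0].
  by exists set0, (fun=> k0); split=> // u; rewrite oltx0.
set μ := cnf_sum e l in IH *; set B := derivs A μ.
have rkB : ranked B (ω^(e l)).
  by split; [apply: rank_ge_derivs | rewrite derivs_add].
pose W q := trim (above A q) μ.
have W_up q : up_closed A (W q) by apply: up_closed_trans (above_up A q) (trim_up _ _).
have /choice[R /choice[F hRF]] : forall q, exists R (F : nat -> K), B q ->
    [/\ R `<=` W q, rank_ge R μ & forall i, (i < l)%N ->
    [/\ layer R e i = R `&` layer (W q) e i,
        keeps_cnf (e i) (layer R e i) (layer (W q) e i) &
        forall t, layer R e i t -> f t = F i]].
  move=> q; have [Bq|nBq] := pselect (B q); last by exists set0, (fun=> k0).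
  have [R [F h]] := IH _ (ranked_trim (rank_ge_above Bq)).
  by exists R, F.
(* Finitely many combined colours occur, so one choice of colours for the upper layers serves for
   all pieces. *)
pose g t := (f t, [ffun i : 'I_l => F t i]).
have [B' [[c G] [kB' geB' gB']]] :=
  @monochromatic_opow _ g _ _ (enum {: K * {ffun 'I_l -> K}}) rkB (fun t _ => mem_enum _ (g t)).
have B'B : B' `<=` B by have [] := kB'.
pose Q := stack B' R.
have RW q t : maxs B' q -> R q t -> W q t by move=> [/B'B/hRF[h _ _] _] /h.
have R_above q t : maxs B' q -> R q t -> (q < t)%O by move=> Mq /(RW _ _ Mq)[[]].
have R_rk q : maxs B' q -> ranked (R q) μ.
  move=> [/B'B Bq _]; have [h1 h2 _] := hRF q Bq.
  by apply: ranked_sub h1 _ h2; apply: ranked_trim; apply: rank_ge_above.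
have dQ : derivs Q μ = B' := stack_derivs R_above R_rk.
have R_up q : maxs B' q -> up_closed Q (R q) by apply: stack_up.
have QA : Q `<=` A.
  move=> t [/B'B/derivs_sub //|[q Mq /(RW _ _ Mq)[[]] //]].
have geQ : rank_ge Q (cnf_sum e l.+1) by apply: rank_geD (opow_gt0 _) _; rewrite dQ.
have layl : layer Q e l = B'.
  rewrite layerE -/μ dQ; apply/seteqP; split=> [t []//|t Bt]; split=> //.
  move=> /(derivs_mono B'B); by rewrite rkB.2.
have layAl : layer A e l = B.
  by rewrite layerE -/μ -/B /trim rkB.2 setD0.
have notB i t (D : set P) : (i < l)%N -> layer D e i t -> ~ derivs D μ t.
  by move=> il [_ nD] /(derivs_anti (cnf_sum_le e il)).
have inR i t : (i < l)%N -> layer Q e i t -> exists2 q, maxs B' q & layer (R q) e i t.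
  move=> il Lt; have [Bt|[q Mq Rt]] := layer_sub Lt.
    by case: (notB _ _ _ il Lt); rewrite dQ.
  by exists q => //; apply/(layer_up _ _ (R_up q Mq) Rt).
(* Among the indices up to l, [insub] fails only at l, the lowest layer, which has colour [c]. *)
exists Q, (fun i => if insub i is Some j then G j else c); split=> // i.
rewrite ltnS leq_eqVlt => /orP[/eqP ->|il].
  rewrite layl layAl; split=> //.
    apply/seteqP; split=> t; first by move=> Bt; split; [left | apply: B'B].
    move=> [[//|[q Mq Rt]]] Bt; case: (RW _ _ Mq Rt) => At [].
    exact/(derivs_up _ (above_up A q) At).
  by move=> t /gB'[]; rewrite insubF // ltnn.
split.
- apply/seteqP; split=> t.
    move=> Lt; split; first exact: layer_sub Lt.
    have [q Mq LR] := inR _ _ il Lt; have [Bq _] := Mq.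
    have [_ _ /(_ i il)[h _ _]] := hRF q (B'B _ Bq).
    move: LR; rewrite h => -[Rt]; have := RW _ _ Mq Rt => Wt.
    by move/(layer_up _ _ (W_up q) Wt).
  move=> [[Bt|[q Mq Rt]] LA]; first by case: (notB _ _ _ il LA); apply: B'B.
  apply/(layer_up _ _ (R_up q Mq) Rt).
  have [_ _ /(_ i il)[-> _ _]] := hRF q (B'B _ Mq.1); split=> //.
  by apply/(layer_up _ _ (W_up q)) => //; apply: RW Rt.
- have sub : layer Q e i `<=` layer A e i.
    move=> t /(inR _ _ il)[q Mq].
    have [_ _ /(_ i il)[-> _ _]] := hRF q (B'B _ Mq.1) => -[Rt].
    by move/(layer_up _ _ (W_up q) (RW _ _ Mq Rt)).
  split=> // η m j an em jm; split=> // s t Ls Lt st.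
  have [q Mq LRs] := inR _ _ il Ls.
  have upQ := layer_up_closed e i (R_up q Mq).
  have LRt : layer (R q) e i t by apply: upQ.2 st Lt.
  have [_ /(_ s t LRs LRt st) <-] := keeps_up (cnf_prod η j) upQ.
  have [_ _ /(_ i il)[_ [sW kW] _]] := hRF q (B'B _ Mq.1).
  have [_ /(_ s t LRs LRt st) ->] := kW η m j an em jm.
  have [_ h] := keeps_up (cnf_prod η j) (layer_up_closed e i (W_up q)).
  by apply: h => //; apply: sW.
- move=> t /(inR _ _ il)[q [B'q mq] LRt].
  have [_ _ /(_ i il)[_ _ ->]] := hRF q (B'B _ B'q) => //.
  have [_ <-] := gB' q B'q.
  by rewrite (insubT (fun i => i < l)%N il) ffunE.
Qed.

(** * The function τ and the separation *)

Lemma derivs_max A t : (exists x, ~ derivs A x t) -> A t ->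
  exists ρ, forall x, derivs A x t <-> (x <= ρ)%O.
Proof.
move=> /omin_ex[y ny ymin] At.
have [ρ ρy nρ] : exists2 ρ, (ρ < y)%O & ~ derivs A (ρ + 1) t.
  apply: contrapT => h; apply: ny; apply/derivsP; split=> // u uy.
  have : derivs A (u + 1) t by apply: contrapT => nu; apply: h; exists u.
  by rewrite derivsS => /derivE[].
exists ρ => x; split=> [Ax|xρ].
  by rewrite leNgt; apply/negP => /oleS ρx; apply: nρ; apply: derivs_anti Ax.
by apply: derivs_anti xρ _ _; apply: contrapT; apply: ymin.
Qed.

(** The maximum that defines τ is attained: the least y with t outside A^(δ·y) exists because δ·y >=
    y, and it is a successor by continuity of multiplication. *)
Lemma tau_max A δ t : (0 < δ)%O -> (exists x, ~ derivs A x t) -> A t ->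
  derivs A (δ * tau A δ t) t /\ forall x, derivs A (δ * x) t -> (x <= tau A δ t)%O.
Proof.
move=> δ0 ex At; have [ρ hρ] := derivs_max ex At.
suff [u [h1 h2]] : exists u, derivs A (δ * u) t /\ forall x, derivs A (δ * x) t -> (x <= u)%O.
  rewrite /tau /omax; case: xgetP => [_ -> []//|/(_ u)]; by case.
have [|y ny ymin] := @omin_ex (fun y => ~ derivs A (δ * y) t).
  exists (ρ + 1) => /hρ h; have := le_trans (le_omull (ρ + 1) δ0) h.
  by rewrite oleS ltxx.
have [u uy nu] : exists2 u, (u < y)%O & ~ derivs A (δ * (u + 1)) t.
  apply: contrapT => h; apply: ny; apply/hρ/omul_leP => u uy; rewrite -omulS.
  by apply/hρ; apply: contrapT => nu; apply: h; exists u.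
exists u; split; first by apply: contrapT; apply: ymin.
move=> x Ax; rewrite leNgt; apply/negP => /oleS ux; apply: nu.
by apply: derivs_anti Ax; apply: le_omul.
Qed.

Lemma tau_sep A δ s t : (0 < δ)%O -> (exists x, derivs A x = set0) ->
  A s -> A t -> (s < t)%O -> tau A δ s = tau A δ t <-> ~ sep A δ s t.
Proof.
move=> δ0 [z z0] As At st.
have ex r : exists x, ~ derivs A x r by exists z; rewrite z0.
have [s1 s2] := tau_max δ0 (ex s) As; have [t1 t2] := tau_max δ0 (ex t) At.
split=> [e [x Axs]|ns].
  apply; apply: derivs_anti t1; apply: le_omul => //; rewrite -e; exact: s2.
apply/eqP; rewrite eq_le; apply/andP; split; last first.
  by apply: s2; apply: derivs_down t1.
by apply: t2; apply: contrapT => n; apply: ns; exists (tau A δ s).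
Qed.

(** Both sets have the same rank, so the same factorizations occur in [is_separation]. With
    [tau_sep], [keeps_cnf] makes the two predicates agree, and [xget] returns the same value. *)
Lemma separation_eq A A' ξ s t : ranked A (ω^ξ) -> ranked A' (ω^ξ) -> keeps_cnf ξ A A' ->
  Lambda2 A (s, t) -> separation A (s, t) = separation A' (s, t).
Proof.
move=> rk rk' [AA' k] [/= As At st].
have ω0 : ω^ξ <> 0 by apply/olt0x/opow_gt0.
have [rkA rkA'] := ((rankP A ω0).2 rk, (rankP A' ω0).2 rk').
have tauE η m i : antitone_upto η m -> ω^ξ = cnf_prod η m -> (i <= m)%N ->
    tau A (cnf_prod η i) s = tau A (cnf_prod η i) t <->
    tau A' (cnf_prod η i) s = tau A' (cnf_prod η i) t.
  move=> an e im; have pos : (0 < cnf_prod η i)%O by rewrite cnf_prodE; apply: opow_gt0.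
  have [_ /(_ s t As At st) h] := k η m i an e im.
  rewrite (tau_sep pos (ex_intro _ _ rk.2) As At st).
  rewrite (tau_sep pos (ex_intro _ _ rk'.2) (AA' _ As) (AA' _ At) st).
  by split=> n /h.
congr (xget _ _); apply/seteqP; split=> i /= [m [η [an]]].
  rewrite rkA => e im h1 h2; exists m, η; split=> //; first by rewrite rkA'.
    exact/(tauE η m.+1 i.+1 an e im).
  by move=> j ji /(tauE η m.+1 j.+1 an e (leq_trans ji (leqW im))); apply: h2.
rewrite rkA' => e im h1 h2; exists m, η; split=> //; first by rewrite rkA.
  exact/(tauE η m.+1 i.+1 an e im).
by move=> j ji /(tauE η m.+1 j.+1 an e (leq_trans ji (leqW im))); apply: h2.
Qed.

Lemma ranked_layer A (e : nat -> Ord) l i : rank_ge A (cnf_sum e l) -> (i < l)%N ->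
  ranked (layer A e i) (ω^(e i)).
Proof.
move=> ge il; rewrite layerE; apply: ranked_trim; apply: rank_ge_derivs.
by apply: rank_ge_le ge; apply: (@cnf_sum_le e i.+1).
Qed.

End Derivatives.

(** A set without maximal elements is never stripped, so it would lie in every derivative of the
    tree. *)
Lemma ranked_wf (d : Order.disp_t) (P : porderType d) ξ : ranked [set: P] ξ ->
  forall A : set P, A !=set0 -> exists2 m, A m & forall s, A s -> ~ (m < s)%O.
Proof.
move=> [_ P0] A [t At]; apply: contrapT => h.
suff : derivs [set: P] ξ t by rewrite P0.
elim/ord_ind: ξ t At {P0} => ξ IH t At; apply/derivsP; split=> // u uξ.
apply: contrapT => n; apply: h; exists t => // s As ts; apply: n; exists s => //.
exact: IH.
Qed.

Theorem theorem4p8 (γ : Ord) (γ_neq0 : γ <> ozero)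
    (l : nat) (ε : nat -> Ord)
    (ε_anti : forall i j : nat, (i <= j <= l)%N -> (ε j <= ε i)%O)
    (γE : γ = cnf_sum ε l.+1)
    (d : Order.disp_t) (P : porderType d) (P_tree : is_tree P)
    (P_rank : rank [set: P] = γ)
    (k : nat) (f : P -> 'I_k.+1) :
  exists (Q : set P) (F : 'I_l.+1 -> 'I_k.+1),
    rank Q = rank [set: P] /\
    forall i : 'I_l.+1,
      [/\ layer Q ε i = Q `&` layer [set: P] ε i,
          forall st : P * P, Lambda2 (layer Q ε i) st ->
            separation (layer Q ε i) st = separation (layer [set: P] ε i) st
        & forall t : P, layer Q ε i t -> f t = F i].
Proof.
have rkP : ranked [set: P] γ by apply/rankP.
have wf := ranked_wf rkP.
rewrite γE in rkP; have [Q [F [_ geQ h]]] := layered_subset wf P_tree ord0 f rkP.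
exists Q, (fun i => F i); split.
  rewrite P_rank; apply/rankP => //; rewrite γE; exact: ranked_sub rkP geQ.
move=> i; have [h1 h2 h3] := h i (ltn_ord i); split=> // -[s t].
by apply: separation_eq h2; apply: ranked_layer (ltn_ord i) => //; apply: rkP.1.
Qed.
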